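(* Let $W_{\boldsymbol\lambda}$ be a bilateral weighted shift in $\ell^2(\mathbb{Z})$ with weights $\boldsymbol\lambda=\{\lambda_n\}_{n=-\infty}^\infty\subseteq\mathbb{C}$. Assume that $C$ is a conjugation on $\ell^2(\mathbb{Z})$ such that $C\mathcal{E}\subseteq\mathcal{D}^\infty(W_{\boldsymbol\lambda})$. Then $W_{\boldsymbol\lambda}$ is $C$-symmetric if and only if one of the following conditions holds: (i) $\{\lambda_n\}_{n=-\infty}^\infty\subseteq\mathbb{C}\setminus\{0\}$ and there exists $k\in\mathbb{Z}$ such that $|\lambda_n|=|\lambda_{k-n}|$ for all $n\in\mathbb{Z}$; (ii) $W_{\boldsymbol\lambda}$ is unitarily equivalent to $W_{\boldsymbol\gamma}^*\oplus W_{\boldsymbol\gamma}$, where $W_{\boldsymbol\gamma}$ is an injective unilateral weighted shift on $\ell^2(\mathbb{N})$; (iii) $W_{\boldsymbol\lambda}$ is unitarily equivalent to $W_{\boldsymbol\gamma}^*\oplus W_{\boldsymbol\gamma}\oplus\bigoplus_{i=1}^k J_{\boldsymbol\lambda^{(i)}}$ (for some $k\in\mathbb{N}$), where $W_{\boldsymbol\gamma}$ is an injective unilateral weighted shift on $\ell^2(\mathbb{N})$ and each $J_{\boldsymbol\lambda^{(i)}}$ is a complex selfadjoint truncated weighted shift; (iv) $W_{\boldsymbol\lambda}$ is unitarily equivalent to a complex symmetric unilateral weighted shift on $\ell^2(\mathbb{N})$.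
   Context: $\mathbb{N}=\{1,2,\ldots\}$. $\mathcal{E}=\{e_n\}_{n\in\mathbb{Z}}$ is the canonical orthonormal basis of $\ell^2(\mathbb{Z})$. $\mathcal{D}(T)$ is the domain of an operator $T$ and $\mathcal{D}^\infty(T)=\bigcap_{n=1}^\infty\mathcal{D}(T^n)$. The bilateral weighted shift $W_{\boldsymbol\lambda}$ with weights $\boldsymbol\lambda=\{\lambda_n\}_{n=-\infty}^\infty\subseteq\mathbb{C}$ is the (possibly unbounded) operator in $\ell^2(\mathbb{Z})$ with $\mathcal{D}(W_{\boldsymbol\lambda})=\{f\in\ell^2(\mathbb{Z}):\sum_{n=-\infty}^\infty|f(n)\lambda_n|^2<\infty\}$ and $(W_{\boldsymbol\lambda}f)(n)=\lambda_{n-1}f(n-1)$ for $n\in\mathbb{Z}$. The unilateral weighted shift $W_{\boldsymbol\gamma}$ with weights $\boldsymbol\gamma=\{\gamma_n\}_{n=1}^\infty\subseteq\mathbb{C}$ is the operator in $\ell^2(\mathbb{N})$ with $\mathcal{D}(W_{\boldsymbol\gamma})=\{f\in\ell^2(\mathbb{N}):\sum_{n=1}^\infty|f(n)\gamma_n|^2<\infty\}$ and $(W_{\boldsymbol\gamma}f)(n)=\gamma_{n-1}f(n-1)$ for $n\in\mathbb{N}$, with $\gamma_0=f(0):=0$. For $k\in\mathbb{N}$ and $\boldsymbol\mu=\{\mu_1,\ldots,\mu_{k-1}\}\subseteq\mathbb{C}$, the truncated weighted shift $J_{\boldsymbol\mu}$ is the linear operator on $\mathbb{C}^k$ with $J_{\boldsymbol\mu}e_i=\mu_ie_{i+1}$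 for $i=1,\ldots,k-1$ and $J_{\boldsymbol\mu}e_k=0$. A conjugation on a complex separable Hilbert space $\mathcal{H}$ is an antilinear operator $C$ on $\mathcal{H}$ with $C^2=I$ and $\langle Cf,Cg\rangle=\langle g,f\rangle$ for all $f,g\in\mathcal{H}$. A densely defined operator $T$ in $\mathcal{H}$ is $C$-symmetric if $T\subseteq CT^*C$ and $C$-selfadjoint if $T=CT^*C$. It is complex symmetric (resp. complex selfadjoint) if it is $C$-symmetric (resp. $C$-selfadjoint) with respect to some conjugation $C$ on $\mathcal{H}$.
   Formalization: As stated, ''if'' fails for fixed C (λ_n=1, Ce_n=e_n). Here ''only if'' is for the given C; conversely (i)–(iii) give some conjugation C' with C'E ⊆ D^∞(W) and W C'-symmetric, and (iv) gives only that W is complex symmetric. *)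

(* Defs.v *)
From HB Require Import structures.
From mathcomp Require Import all_boot all_order all_algebra complex ring.
From mathcomp Require Import all_classical all_reals all_analysis.

Set Implicit Arguments.
Unset Strict Implicit.
Unset Printing Implicit Defensive.

Import Order.TTheory GRing.Theory Num.Theory.

Local Open Scope classical_set_scope.
Local Open Scope ring_scope.

(* The Hilbert spaces are the spaces l2 R I of square-summable families of
   complex numbers indexed by I: l^2(Z) is l2 R int, l^2({1, 2, ...}) is
   l2 R nat with n standing for the index n+1, C^k is l2 R 'I_k, and orthogonal
   sums are taken over disjoint unions of index types.  A (partially defined)
   operator from l2 R I to itself is identified with its graph, so that
   inclusion and equality of operators are those of graphs. *)

Definition abs2 (R : realType) (z : R[i]) : R := Normc.normc z ^+ 2.

Definition square_summable (R : realType) (I : choiceType) :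
    {pred I -> R[i]} :=
  fun f => (\esum_(i in [set: I]) (abs2 (f i))%:E < +oo)%E.

Record l2 (R : realType) (I : choiceType) := L2 {
  l2_fun :> I -> R[i];
  l2_funP : l2_fun \in @square_summable R I }.

HB.instance Definition _ (R : realType) (I : choiceType) :=
  [isSub for @l2_fun R I].
HB.instance Definition _ (R : realType) (I : choiceType) :=
  [Choice of l2 R I by <:].

Lemma abs2E (R : realType) (z : R[i]) :
  abs2 z = complex.Re z ^+ 2 + complex.Im z ^+ 2.
Proof.
by case: z => a b; rewrite /abs2 /= sqr_sqrtr// addr_ge0// sqr_ge0.
Qed.

Lemma abs2_ge0 (R : realType) (z : R[i]) : 0 <= abs2 z.
Proof. exact: sqr_ge0. Qed.

Lemma abs2M (R : realType) (z w : R[i]) : abs2 (z * w) = abs2 z * abs2 w.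
Proof. by rewrite /abs2 Normc.normcM exprMn. Qed.

Lemma abs2N (R : realType) (z : R[i]) : abs2 (- z) = abs2 z.
Proof. by rewrite !abs2E; case: z => a b /=; rewrite !sqrrN. Qed.

Lemma abs2D (R : realType) (z w : R[i]) :
  abs2 (z + w) <= 2 * abs2 z + 2 * abs2 w.
Proof.
rewrite !abs2E; case: z w => a b [c d] /=.
rewrite -subr_ge0 [leRHS](_ : _ = (a - c) ^+ 2 + (b - d) ^+ 2).
  by rewrite addr_ge0// sqr_ge0.
by ring.
Qed.

Lemma esumZl_lt (R : realType) (I : choiceType) (c : R) (a : I -> R) :
  0 <= c -> (forall i, 0 <= a i) ->
  (\esum_(i in [set: I]) (a i)%:E < +oo)%E ->
  (\esum_(i in [set: I]) (c * a i)%:E < +oo)%E.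
Proof.
move=> c0 a0 aoo.
have af : (\esum_(i in [set: I]) (a i)%:E)%E \is a fin_num.
  by rewrite ge0_fin_numE//; apply: esum_ge0 => i _; rewrite lee_fin.
apply: (@le_lt_trans _ _ (c%:E * \esum_(i in [set: I]) (a i)%:E)%E); last first.
  by rewrite -(fineK af) -EFinM ltry.
apply: ge_ereal_sup => _ /= [A [fA _] <-].
under eq_fsbigr do rewrite EFinM.
rewrite -ge0_mule_fsumr; last by move=> i; rewrite lee_fin.
rewrite lee_wpmul2l ?lee_fin//; apply: ereal_sup_ubound => /=.
by exists A.
Qed.

Lemma square_summable0 (R : realType) (I : choiceType) :
  0 \in @square_summable R I.
Proof.
rewrite unfold_in /square_summable esum1 ?ltry// => i _.
by rewrite abs2E /= expr0n addr0.
Qed.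

Lemma square_summableZ (R : realType) (I : choiceType) (a : R[i])
    (f : I -> R[i]) :
  f \in @square_summable R I -> (fun i => a * f i) \in @square_summable R I.
Proof.
rewrite !unfold_in /square_summable => ff.
under eq_esum do rewrite abs2M.
by apply: esumZl_lt => // *; exact: abs2_ge0.
Qed.

Lemma square_summableD (R : realType) (I : choiceType) (f g : I -> R[i]) :
  f \in @square_summable R I -> g \in @square_summable R I ->
  f + g \in @square_summable R I.
Proof.
rewrite !unfold_in /square_summable => ff gg.
apply: (@le_lt_trans _ _ (\esum_(i in [set: I])
    ((2 * abs2 (f i))%:E + (2 * abs2 (g i))%:E))%E).
  by apply: le_esum => i _; rewrite -EFinD lee_fin abs2D.
rewrite esumD; last 2 first.
- by move=> i _; rewrite lee_fin mulr_ge0// abs2_ge0.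
- by move=> i _; rewrite lee_fin mulr_ge0// abs2_ge0.
by apply: lte_add_pinfty; apply: esumZl_lt => // i; exact: abs2_ge0.
Qed.

Lemma square_summable_zmod (R : realType) (I : choiceType) :
  zmod_closed (@square_summable R I).
Proof.
split; first exact: square_summable0.
move=> f g ff gg; apply: square_summableD => //.
move: gg; rewrite !unfold_in /square_summable.
by under [in X in _ -> X]eq_esum do rewrite abs2N.
Qed.

HB.instance Definition _ (R : realType) (I : choiceType) :=
  GRing.isZmodClosed.Build (I -> R[i]) (@square_summable R I)
    (@square_summable_zmod R I).
HB.instance Definition _ (R : realType) (I : choiceType) :=
  [SubChoice_isSubZmodule of l2 R I by <:].

Definition l2_scale (R : realType) (I : choiceType) (a : R[i]) (f : l2 R I) :
  l2 R I := L2 (square_summableZ a (l2_funP f)).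

Lemma l2_scaleA (R : realType) (I : choiceType) (a b : R[i]) (f : l2 R I) :
  l2_scale a (l2_scale b f) = l2_scale (a * b) f.
Proof. by apply/val_inj/funext => i; rewrite /= mulrA. Qed.

Lemma l2_scale1 (R : realType) (I : choiceType) :
  left_id 1 (@l2_scale R I).
Proof. by move=> f; apply/val_inj/funext => i; rewrite /= mul1r. Qed.

Lemma l2_scaleDr (R : realType) (I : choiceType) :
  right_distributive (@l2_scale R I) +%R.
Proof. by move=> a f g; apply/val_inj/funext => i; rewrite /= mulrDr. Qed.

Lemma l2_scaleDl (R : realType) (I : choiceType) (f : l2 R I) :
  {morph (@l2_scale R I)^~ f : a b / a + b}.
Proof. by move=> a b; apply/val_inj/funext => i; rewrite /= mulrDl. Qed.

HB.instance Definition _ (R : realType) (I : choiceType) :=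
  GRing.Zmodule_isLmodule.Build R[i] (l2 R I)
    (@l2_scaleA R I) (@l2_scale1 R I) (@l2_scaleDr R I) (@l2_scaleDl R I).

Lemma l2_basis_subproof (R : realType) (I : choiceType) (n : I) :
  (fun i => (i == n)%:R : R[i]) \in @square_summable R I.
Proof.
rewrite unfold_in /square_summable (esumID [set n])//; last first.
  by move=> i _; rewrite lee_fin abs2_ge0.
rewrite setTI esum_set1 ?lee_fin ?abs2_ge0// esum1 ?adde0 ?ltry// => i /= [_].
by move=> /eqP/negPf ->; rewrite abs2E /= expr0n addr0.
Qed.

Definition l2_basis (R : realType) (I : choiceType) (n : I) : l2 R I :=
  L2 (l2_basis_subproof R n).

(* Meaningful for absolutely summable families only. *)
Definition rsum (R : realType) (I : choiceType) (a : I -> R) : R :=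
  fine (\esum_(i in [set: I]) ((EFin \o a)^\+)%E i
        - \esum_(i in [set: I]) ((EFin \o a)^\-)%E i)%E.

Definition csum (R : realType) (I : choiceType) (a : I -> R[i]) : R[i] :=
  Complex (rsum (fun i => complex.Re (a i))) (rsum (fun i => complex.Im (a i))).

(* The family summed here is absolutely summable, |f i| |g i| being at most
   (|f i|^2 + |g i|^2) / 2. *)
Definition dotl2 (R : realType) (I : choiceType) (f g : l2 R I) : R[i] :=
  csum (fun i => f i * (g i)^*).

Definition norml2 (R : realType) (I : choiceType) (f : l2 R I) : R :=
  Num.sqrt (fine (\esum_(i in [set: I]) (abs2 (f i))%:E)).

Definition operator (R : realType) (I : choiceType) := set (l2 R I * l2 R I).

Definition dom (R : realType) (I : choiceType) (T : operator R I) :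
  set (l2 R I) := [set f | exists g, T (f, g)].

Fixpoint oppow (R : realType) (I : choiceType) (T : operator R I) (n : nat) :
    operator R I :=
  if n is m.+1 then
    [set fg | exists h, oppow T m (fg.1, h) /\ T (h, fg.2)]
  else [set fg | fg.2 = fg.1].

Definition dom_infty (R : realType) (I : choiceType) (T : operator R I) :
  set (l2 R I) := [set f | forall n, (0 < n)%N -> dom (oppow T n) f].

Definition densely_defined (R : realType) (I : choiceType)
    (T : operator R I) : Prop :=
  forall (f : l2 R I) (e : R), 0 < e -> exists2 g, dom T g & norml2 (f - g) < e.

Definition injective_op (R : realType) (I : choiceType)
    (T : operator R I) : Prop :=
  forall f g h, T (f, h) -> T (g, h) -> f = g.

Definition adjoint (R : realType) (I : choiceType) (T : operator R I) :
    operator R I :=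
  [set fg | forall h k, T (h, k) -> dotl2 k fg.1 = dotl2 h fg.2].

Definition conjugation (R : realType) (I : choiceType)
    (C : l2 R I -> l2 R I) : Prop :=
  [/\ forall (a : R[i]) f g, C (a *: f + g) = a^* *: C f + C g,
      forall f, C (C f) = f &
      forall f g, dotl2 (C f) (C g) = dotl2 g f].

(* The operator C T C. *)
Definition conj_op (R : realType) (I : choiceType) (C : l2 R I -> l2 R I)
    (T : operator R I) : operator R I :=
  [set fg | exists2 h, T (C fg.1, h) & fg.2 = C h].

Definition C_symmetric (R : realType) (I : choiceType)
    (C : l2 R I -> l2 R I) (T : operator R I) : Prop :=
  densely_defined T /\ T `<=` conj_op C (adjoint T).

Definition C_selfadjoint (R : realType) (I : choiceType)
    (C : l2 R I -> l2 R I) (T : operator R I) : Prop :=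
  densely_defined T /\ T = conj_op C (adjoint T).

Definition complex_symmetric (R : realType) (I : choiceType)
    (T : operator R I) : Prop :=
  exists2 C, conjugation C & C_symmetric C T.

Definition complex_selfadjoint (R : realType) (I : choiceType)
    (T : operator R I) : Prop :=
  exists2 C, conjugation C & C_selfadjoint C T.

Definition unitary (R : realType) (I J : choiceType)
    (U : l2 R I -> l2 R J) : Prop :=
  [/\ forall (a : R[i]) f g, U (a *: f + g) = a *: U f + U g,
      forall g, exists f, U f = g &
      forall f g, dotl2 (U f) (U g) = dotl2 f g].

Definition unitarily_equivalent (R : realType) (I J : choiceType)
    (T : operator R I) (S : operator R J) : Prop :=
  exists2 U : l2 R I -> l2 R J, unitary U &
    forall f g, T (f, g) <-> S (U f, U g).

Definition opsum (R : realType) (I J : choiceType)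
    (T : operator R I) (S : operator R J) : operator R (I + J)%type :=
  [set fg : l2 R _ * l2 R _ | exists p q, [/\ T p, S q,
    forall i, fg.1 (inl i) = p.1 i /\ fg.2 (inl i) = p.2 i &
    forall j, fg.1 (inr j) = q.1 j /\ fg.2 (inr j) = q.2 j]].

Definition opbigsum (R : realType) (k : nat) (I : 'I_k -> choiceType)
    (T : forall i, operator R (I i)) : operator R {i : 'I_k & I i} :=
  [set fg : l2 R _ * l2 R _ | forall i, exists2 p, T i p &
    forall x : I i, fg.1 (existT _ i x) = p.1 x /\ fg.2 (existT _ i x) = p.2 x].

(* In the three shifts below, the requirement that the image lie in the space
   (through the type of fg.2) is the square-summability of the products
   weight * coefficient, that is, the domain condition. *)

Definition bilateral_shift (R : realType) (lam : int -> R[i]) :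
    operator R int :=
  [set fg : l2 R _ * l2 R _ |
    forall n : int, fg.2 n = lam (n - 1) * fg.1 (n - 1)].

(* gam n stands for the weight of index n+1. *)
Definition unilateral_shift (R : realType) (gam : nat -> R[i]) :
    operator R nat :=
  [set fg : l2 R _ * l2 R _ | fg.2 0%N = 0 /\
    forall n : nat, fg.2 n.+1 = gam n * fg.1 n].

(* The truncated shift on C^(m+1), with weights mu 0, ..., mu (m-1). *)
Definition truncated_shift (R : realType) (m : nat) (mu : 'I_m -> R[i]) :
    operator R 'I_m.+1 :=
  [set fg : l2 R _ * l2 R _ | fg.2 ord0 = 0 /\
    forall i : 'I_m, fg.2 (lift ord0 i) = mu i * fg.1 (widen_ord (leqnSn m) i)].

Definition reflected_weights (R : realType) (lam : int -> R[i]) : Prop :=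
  (forall n, lam n != 0) /\
  exists k : int, forall n : int, `|lam n| = `|lam (k - n)|.

Definition equiv_shift_sum (R : realType) (lam : int -> R[i]) : Prop :=
  exists gam : nat -> R[i],
    injective_op (unilateral_shift gam) /\
    unitarily_equivalent (bilateral_shift lam)
      (opsum (adjoint (unilateral_shift gam)) (unilateral_shift gam)).

Definition equiv_shift_sum_truncated (R : realType) (lam : int -> R[i]) :
    Prop :=
  exists (gam : nat -> R[i]) (k : nat) (m : 'I_k -> nat)
      (mu : forall i, 'I_(m i) -> R[i]),
    [/\ (0 < k)%N, injective_op (unilateral_shift gam),
        forall i, complex_selfadjoint (truncated_shift (@mu i)) &
        unitarily_equivalent (bilateral_shift lam)
          (opsum (opsum (adjoint (unilateral_shift gam)) (unilateral_shift gam))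
                 (opbigsum (fun i => truncated_shift (@mu i))))].

Definition equiv_symmetric_unilateral (R : realType) (lam : int -> R[i]) :
    Prop :=
  exists gam : nat -> R[i],
    complex_symmetric (unilateral_shift gam) /\
    unitarily_equivalent (bilateral_shift lam) (unilateral_shift gam).

(* Main.v *)
Require Import Defs.
From mathcomp Require Import all_boot all_order all_algebra complex.
From mathcomp Require Import ring lra zify.
From mathcomp Require Import all_classical all_reals all_analysis.
Import Order.TTheory GRing.Theory Num.Theory.
Local Open Scope classical_set_scope.
Local Open Scope ring_scope.

Set Implicit Arguments.
Unset Strict Implicit.
Unset Printing Implicit Defensive.

(* Let W be the bilateral shift and k(m, n) = <C e_n, e_m>, a symmetric kernel.
   Testing W <= C W^* C on e_n and on C e_n gives
     conj(lam n) k(m, n+1) = conj(lam m) k(m+1, n)  and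
     lam m k(m, n+1) = lam n k(m+1, n),
   so k(p, q) <> 0 forces |lam (p-1)| = |lam q| and propagates along the
   antidiagonal p + q as long as the weights do not vanish.  Without zero
   weights this is (i).  If the zeros are unbounded on both sides, the finite
   blocks between consecutive zeros can be concatenated in any order into a
   unilateral shift, which is (iv).  Otherwise the propagation shows that both
   tails of the weights are nonzero and match in modulus, and that C preserves
   the finite-dimensional part between the two tails.  This part is taken as a
   single truncated shift, some of whose weights may vanish: its individual
   blocks need not be complex selfadjoint, since C may exchange them.

   Conversely, in each of the cases (i)-(iii), W = C W^* C for a conjugation C
   built from flips e_n |-> a_n e_(s n) and, in (iii), from the conjugations of
   the truncated shifts; such a C maps e_n, which belongs to D^oo of the adjoint
   of W, into D^oo(W). *)

(** * Real and complex sums *)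

Section real_sums.
Variables (R : realType) (I : choiceType).
Implicit Types a b x y : I -> R.

Definition rsummable a := summable [set: I] (EFin \o a).

Definition nnsum a : R := fine (\esum_(i in [set: I]) (a i)%:E).

Lemma rsummable_le a b :
  (forall i, `|a i| <= b i) -> rsummable b -> rsummable a.
Proof.
move=> ab; apply: le_lt_trans; apply: le_esum => i _ /=.
by rewrite lee_fin (le_trans (ab i))// ler_norm.
Qed.

Lemma rsummableD a b :
  rsummable a -> rsummable b -> rsummable (fun i => a i + b i).
Proof. exact: summableD. Qed.

Lemma ge0_rsummable a : (forall i, 0 <= a i) ->
  (\esum_(i in [set: I]) (a i)%:E < +oo)%E -> rsummable a.
Proof.
move=> a0; apply: le_lt_trans; apply: le_esum => i _ /=.
by rewrite lee_fin ger0_norm.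
Qed.

Lemma rsummable_fin a : (forall i, 0 <= a i) -> rsummable a ->
  (\esum_(i in [set: I]) (a i)%:E)%E \is a fin_num.
Proof.
move=> a0; rewrite /rsummable summableE.
by under eq_esum => i _ do rewrite /= ger0_norm//.
Qed.

Lemma nnsumK a : (forall i, 0 <= a i) -> rsummable a ->
  (nnsum a)%:E = \esum_(i in [set: I]) (a i)%:E.
Proof. by move=> a0 sa; rewrite fineK// rsummable_fin. Qed.

Lemma nnsumD a b : (forall i, 0 <= a i) -> (forall i, 0 <= b i) ->
  rsummable a -> rsummable b -> nnsum (fun i => a i + b i) = nnsum a + nnsum b.
Proof.
move=> a0 b0 sa sb; apply: EFin_inj; rewrite EFinD !nnsumK//.
- by rewrite -esumD// => i _; rewrite lee_fin.
- by move=> i; rewrite addr_ge0.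
- exact: rsummableD.
Qed.

(** [rsum] subtracts the sum of the negative parts from that of the positive parts. Any other
    splitting into nonnegative summable families gives the same value; this yields additivity, since
    positive parts are not additive. *)
Lemma rsumB_nnsum x y : (forall i, 0 <= x i) -> (forall i, 0 <= y i) ->
  rsummable x -> rsummable y ->
  rsum (fun i => x i - y i) = nnsum x - nnsum y.
Proof.
move=> x0 y0 sx sy; rewrite /rsum.
have E0 (z : I -> R) : (forall i, 0 <= z i) ->
    forall i, [set: I] i -> (0 <= (EFin \o z) i)%E.
  by move=> z0 i _; rewrite lee_fin.
have -> : (EFin \o (fun i => x i - y i)) = ((EFin \o x) \- (EFin \o y))%E.
  by apply/funext => i.
rewrite (esumB sx sy (E0 _ x0) (E0 _ y0)).
by rewrite fineB// rsummable_fin.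
Qed.

Lemma rsum_ge0 a : (forall i, 0 <= a i) -> rsummable a -> rsum a = nnsum a.
Proof.
move=> a0 sa; have s0 : rsummable (fun=> 0).
  by apply: ge0_rsummable => //; rewrite esum1// ltry.
have -> : nnsum a = nnsum a - nnsum (fun=> 0).
  by rewrite [nnsum (fun=> 0)]/nnsum esum1// subr0.
by rewrite -rsumB_nnsum//; congr rsum; apply/funext => i; rewrite subr0.
Qed.

Let pos a i := Num.max (a i) 0.
Let neg a i := Num.max (- a i) 0.

Let pos_ge0 a i : 0 <= pos a i. Proof. by rewrite le_max lexx orbT. Qed.
Let neg_ge0 a i : 0 <= neg a i. Proof. by rewrite le_max lexx orbT. Qed.

Let posB a i : pos a i - neg a i = a i.
Proof.
rewrite /pos /neg; have [a0|a0] := leP 0 (a i).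
  by rewrite max_r ?subr0// oppr_le0.
by rewrite max_l ?sub0r ?opprK// oppr_ge0 ltW.
Qed.

Let norm_summable a : rsummable a -> rsummable (fun i => `|a i|).
Proof.
apply: le_lt_trans; apply: le_esum => i _ /=.
by rewrite lee_fin normr_id.
Qed.

Let pos_summable a : rsummable a -> rsummable (pos a).
Proof.
move=> /norm_summable; apply: rsummable_le => i.
by rewrite ger0_norm// ge_max normr_ge0 andbT ler_norm.
Qed.

Let neg_summable a : rsummable a -> rsummable (neg a).
Proof.
move=> /norm_summable; apply: rsummable_le => i.
by rewrite ger0_norm// ge_max normr_ge0 andbT -normrN ler_norm.
Qed.

Lemma rsumD a b : rsummable a -> rsummable b ->
  rsum (fun i => a i + b i) = rsum a + rsum b.
Proof.
have e c : rsummable c -> rsum c = nnsum (pos c) - nnsum (neg c).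
  move=> sc; rewrite -(rsumB_nnsum (pos_ge0 c) (neg_ge0 c));
    [|exact: pos_summable|exact: neg_summable].
  by congr rsum; apply/funext => i; rewrite posB.
move=> sa sb.
have [pa pb] := (pos_summable sa, pos_summable sb).
have [na nb] := (neg_summable sa, neg_summable sb).
have pab0 i : 0 <= pos a i + pos b i by rewrite addr_ge0.
have nab0 i : 0 <= neg a i + neg b i by rewrite addr_ge0.
rewrite (e a)// (e b)// addrACA -opprD.
rewrite -(nnsumD (pos_ge0 a) (pos_ge0 b) pa pb).
rewrite -(nnsumD (neg_ge0 a) (neg_ge0 b) na nb).
rewrite -(rsumB_nnsum pab0 nab0 (rsummableD pa pb) (rsummableD na nb)).
by congr rsum; apply/funext => i; rewrite opprD addrACA !posB.
Qed.

End real_sums.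

Lemma esum_reindex_supp (R : realType) (I J : choiceType) (h : J -> I)
    (a : I -> \bar R) :
  injective h -> (forall i, (0 <= a i)%E) ->
  (forall i, ~ range h i -> a i = 0%E) ->
  (\esum_(i in [set: I]) a i = \esum_(j in [set: J]) a (h j))%E.
Proof.
move=> hI a0 ah; rewrite (esumID (range h)) => [|i _]; last exact: a0.
rewrite !setTI [X in (_ + X)%E]esum1 ?adde0; last by move=> i; exact: ah.
by rewrite esum_image// => x y _ _; exact: hI.
Qed.

Lemma rsum_reindex_supp (R : realType) (I J : choiceType) (h : J -> I)
    (a : I -> R) :
  injective h -> (forall i, ~ range h i -> a i = 0) ->
  rsum a = rsum (a \o h).
Proof.
move=> hI ah; rewrite /rsum; congr (fine (_ - _)%E).
  rewrite (esum_reindex_supp hI) => [|i|i /ah ai].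
  - by apply: eq_esum => j _; rewrite !funeposE.
  - exact: funepos_ge0.
  - by rewrite funeposE /= ai maxxx.
rewrite (esum_reindex_supp hI) => [|i|i /ah ai].
- by apply: eq_esum => j _; rewrite !funenegE.
- exact: funeneg_ge0.
- by rewrite funenegE /= ai oppr0 maxxx.
Qed.

Lemma csum_reindex_supp (R : realType) (I J : choiceType) (h : J -> I)
    (a : I -> R[i]) :
  injective h -> (forall i, ~ range h i -> a i = 0) ->
  csum a = csum (a \o h).
Proof.
by move=> hI ah; congr Complex; apply: rsum_reindex_supp => // i /ah ->.
Qed.

Lemma csum_reindex (R : realType) (I J : choiceType) (h : J -> I)
    (a : I -> R[i]) :
  bijective h -> csum a = csum (a \o h).
Proof.
move=> [g hK gK]; apply: csum_reindex_supp; first exact: can_inj hK.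
by move=> i []; exists (g i).
Qed.

Lemma csum_single (R : realType) (I : choiceType) (n : I) (a : I -> R[i]) :
  (forall i, i != n -> a i = 0) -> csum a = a n.
Proof.
move=> an; rewrite (@csum_reindex_supp _ _ unit (fun=> n)); last 2 first.
- by move=> [] [].
- move=> i nhi; apply: an; apply/eqP => in_; apply: nhi.
  by exists tt.
suff r (c : R) : rsum (fun _ : unit => c) = c.
  by rewrite /csum /= !r; case: (a n).
have e (F : unit -> \bar R) :
    (0 <= F tt)%E -> (\esum_(i in [set: unit]) F i = F tt)%E.
  move=> F0; rewrite (_ : [set: unit] = [set tt]) ?esum_set1//.
  by apply/seteqP; split => [[]|[]].
rewrite /rsum !e ?funeneg_ge0 ?funepos_ge0// funeposE funenegE /=.
have [c0|c0] := leP 0 c.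
  rewrite (@max_l _ _ c%:E) ?lee_fin// max_r ?lee_fin ?oppr_le0//.
  by rewrite sube0.
rewrite (@max_r _ _ c%:E) ?lee_fin 1?ltW// max_l ?lee_fin ?oppr_ge0 1?ltW//.
by rewrite sub0e /= opprK.
Qed.

Definition csummable (R : realType) (I : choiceType) (a : I -> R[i]) :=
  rsummable (fun i => complex.Re (a i)) /\
  rsummable (fun i => complex.Im (a i)).

Lemma csumD (R : realType) (I : choiceType) (a b : I -> R[i]) :
  csummable a -> csummable b ->
  csum (fun i => a i + b i) = csum a + csum b.
Proof.
move=> [ra ia] [rb ib]; rewrite /csum; apply/eqP; rewrite eq_complex /=.
rewrite -(rsumD ra rb) -(rsumD ia ib); apply/andP; split; apply/eqP.
- by congr rsum; apply/funext => i; case: (a i) (b i) => ? ? [].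
- by congr rsum; apply/funext => i; case: (a i) (b i) => ? ? [].
Qed.

(** * The inner product of square-summable families *)

Section dotl2.
Variables (R : realType) (I : choiceType).
Implicit Types f g h : l2 R I.

Lemma rsummable_abs2 f : rsummable (fun i => abs2 (f i)).
Proof.
apply: ge0_rsummable; first by move=> i; exact: abs2_ge0.
exact: (l2_funP f).
Qed.

Lemma csummable_dot f g : csummable (fun i => f i * (g i)^*).
Proof.
have s := rsummableD (rsummable_abs2 f) (rsummable_abs2 g).
(* Both bounds reduce to 2|xy| <= x^2 + y^2, supplied to [nra] through the squares listed below. *)
split; apply: rsummable_le s => i; rewrite !abs2E;
  case: (f i) (g i) => [a b] [c d] /=; rewrite ler_norml; apply/andP;
  have := (sqr_ge0 (a - c), sqr_ge0 (b - d), sqr_ge0 (a + c), sqr_ge0 (b + d),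
           (sqr_ge0 (a - d), sqr_ge0 (b - c), sqr_ge0 (a + d), sqr_ge0 (b + c)),
           (sqr_ge0 a, sqr_ge0 b, sqr_ge0 c, sqr_ge0 d));
  rewrite !expr2 => -[[[[[? ?] ?] ?] [[[? ?] ?] ?]] [[[? ?] ?] ?]]; split.
all: nra.
Qed.

Lemma dotl2Dl f g h : dotl2 (f + g) h = dotl2 f h + dotl2 g h.
Proof.
rewrite -csumD; try exact: csummable_dot.
by congr csum; apply/funext => i; rewrite -mulrDl.
Qed.

Lemma dotl20l h : dotl2 0 h = 0.
Proof.
by apply: (addrI (dotl2 0 h)); rewrite -dotl2Dl !addr0.
Qed.

Lemma dotl2_suml (X : Type) (s : seq X) (F : X -> l2 R I) h :
  dotl2 (\sum_(x <- s) F x) h = \sum_(x <- s) dotl2 (F x) h.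
Proof.
elim: s => [|x s IH]; first by rewrite !big_nil dotl20l.
by rewrite !big_cons dotl2Dl IH.
Qed.

Lemma dotl2_basisr f n : dotl2 f (l2_basis R n) = f n.
Proof.
rewrite /dotl2 (@csum_single _ _ n) /=; first by rewrite eqxx conjC1 mulr1.
by move=> i /negPf ->; rewrite conjC0 mulr0.
Qed.

Lemma dotl2_basisl f n : dotl2 (l2_basis R n) f = (f n)^*.
Proof.
rewrite /dotl2 (@csum_single _ _ n) /=; first by rewrite eqxx mul1r.
by move=> i /negPf ->; rewrite mul0r.
Qed.

Lemma l2_dot_inj f g : (forall h, dotl2 f h = dotl2 g h) -> f = g.
Proof.
move=> fg; apply/val_inj/funext => n.
by have := fg (l2_basis R n); rewrite !dotl2_basisr.
Qed.

(** Used to see that unitary maps, which preserve the inner product, preserve the norm. *)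
Lemma norml2E f : norml2 f = Num.sqrt (complex.Re (dotl2 f f)).
Proof.
have := rsum_ge0 (fun i => abs2_ge0 (f i)) (rsummable_abs2 f).
rewrite /norml2 /dotl2 /csum /= /nnsum => <-; congr (Num.sqrt (rsum _)).
by apply/funext => i; rewrite abs2E; case: (f i) => a b /=; lra.
Qed.

End dotl2.

(** * Weighted composition operators *)

Lemma finite_support_square_summable (R : realType) (I : choiceType)
    (f : I -> R[i]) :
  finite_set [set i | f i != 0] -> f \in @square_summable R I.
Proof.
move=> fin; rewrite unfold_in /square_summable.
rewrite (esumID [set i | f i != 0]) => [|i _]; last by rewrite lee_fin abs2_ge0.
rewrite !setTI [X in (_ + X)%E]esum1 ?adde0; last first.
  by move=> i /negP; rewrite negbK => /eqP ->; rewrite abs2E /= expr0n addr0.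
rewrite esum_fset// => [|i _]; last by rewrite lee_fin abs2_ge0.
by rewrite fsbig_finite//= sumEFin ltry.
Qed.

(** * Restriction and extension along an injection of index sets *)

Section pull_push.
Variables (R : realType) (I J : choiceType) (h : J -> I).
Hypothesis hI : injective h.

Lemma pull_subproof (f : l2 R I) : f \o h \in @square_summable R J.
Proof.
apply: le_lt_trans (l2_funP f).
have := @esum_image R J I [set: J] h (fun i => (abs2 (f i))%:E).
move=> <-; last by move=> x y _ _; exact: hI.
rewrite [leRHS](esumID (range h)) => [|i _]; last by rewrite lee_fin abs2_ge0.
rewrite setTI leeDl//; apply: esum_ge0 => i _.
by rewrite lee_fin abs2_ge0.
Qed.

Definition pull (f : l2 R I) : l2 R J := L2 (pull_subproof f).

(** Extension by zero along [h]. Membership in the range of [h] is decided classically; when [h] is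
    injective the chosen preimage is the only one. *)
Definition push_fun (f : J -> R[i]) (i : I) : R[i] :=
  match pselect (exists j, h j = i) with
  | left e => f (sval (cid e))
  | right _ => 0
  end.

Lemma push_funE f j : push_fun f (h j) = f j.
Proof.
rewrite /push_fun; case: pselect => [e|[]]; last by exists j.
by case: cid => /= k /hI ->.
Qed.

Lemma push_fun0 f i : (forall j, h j != i) -> push_fun f i = 0.
Proof.
by move=> hi; rewrite /push_fun; case: pselect => // -[j hj]; case/eqP: (hi j).
Qed.

Lemma push_subproof (f : l2 R J) : push_fun f \in @square_summable R I.
Proof.
rewrite unfold_in /square_summable (esum_reindex_supp hI).
- by under eq_esum do rewrite push_funE; exact: (l2_funP f).
- by move=> i; rewrite lee_fin abs2_ge0.
- move=> i hi; rewrite push_fun0 ?abs2E /= ?expr0n ?addr0// => j.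
  by apply/eqP => e; apply: hi; exists j.
Qed.

Definition push (f : l2 R J) : l2 R I := L2 (push_subproof f).

Lemma pushE f j : push f (h j) = f j. Proof. exact: push_funE. Qed.

Lemma push0 f i : (forall j, h j != i) -> push f i = 0.
Proof. exact: push_fun0. Qed.

Lemma pushK f : pull (push f) = f.
Proof. by apply/val_inj/funext => j; exact: pushE. Qed.

Lemma dotl2_push f g : dotl2 (push f) g = dotl2 f (pull g).
Proof.
rewrite /dotl2 (csum_reindex_supp hI) => [|i hi].
  by congr csum; apply/funext => j; rewrite /= push_funE.
rewrite push0 ?mul0r// => j.
by apply/eqP => e; apply: hi; exists j.
Qed.

Lemma dotl2_pushr f g : dotl2 f (push g) = dotl2 (pull f) g.
Proof.
rewrite /dotl2 (csum_reindex_supp hI) => [|i hi].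
  by congr csum; apply/funext => j; rewrite /= push_funE.
rewrite push0 ?conjC0 ?mulr0// => j.
by apply/eqP => e; apply: hi; exists j.
Qed.

Lemma pullP (a : R[i]) f g : pull (a *: f + g) = a *: pull f + pull g.
Proof. exact/val_inj/funext. Qed.

Lemma pushP (a : R[i]) f g : push (a *: f + g) = a *: push f + push g.
Proof.
apply/val_inj/funext => i; rewrite /= !fctE /=.
have [[j <-]|hi] := pselect (exists j, h j = i); first by rewrite !push_funE.
rewrite !push_fun0 ?mulr0 ?addr0// => j; apply/eqP => e; apply: hi; by exists j.
Qed.

End pull_push.

(** Common form of the bilateral shift, the unilateral shift, their adjoints and the sum of a
    unilateral shift with its adjoint, so that adjoints and conjugates are computed only once. *)
Definition weighted_comp (R : realType) (I : choiceType) (p : I -> I)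
    (w : I -> R[i]) : operator R I :=
  [set fg : l2 R I * l2 R I | forall i, fg.2 i = w i * fg.1 (p i)].

(* The matrices (w i [p i = j])_(i, j) and (v j [q j = i])_(j, i) are
   conjugate transposes of each other. *)
Definition adjoint_weights (R : realType) (I : choiceType) (p : I -> I)
    (w : I -> R[i]) (q : I -> I) (v : I -> R[i]) :=
  (forall i, w i != 0 -> q (p i) = i /\ v (p i) = (w i)^*) /\
  (forall j, v j != 0 -> p (q j) = j /\ w (q j) = (v j)^*).

Section weighted_comp.
Variables (R : realType) (I : choiceType) (p q : I -> I) (w v : I -> R[i]).
Hypothesis pq : adjoint_weights p w q v.

(** Column j of the matrix of the operator has at most one nonzero entry, in row [q j], even though
    [p] may be injective only on the support of [w]. *)
Lemma weighted_comp_basis j :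
  weighted_comp p w (l2_basis R j, (v j)^* *: l2_basis R (q j)).
Proof.
have [wP vP] := pq; move=> i /=.
have vwi : v j != 0 -> i = q j -> p i = j /\ w i = (v j)^*.
  by move=> /vP + ->.
have [pij|pij] := eqVneq (p i) j; last first.
  rewrite mulr0; have [iqj|_] := eqVneq i (q j); last by rewrite mulr0.
  have [->|/vwi/(_ iqj)[/eqP]] := eqVneq (v j) 0; first by rewrite conjC0 mul0r.
  by rewrite (negPf pij).
have [w0|/wP[]] := eqVneq (w i) 0; last first.
  by rewrite pij => <- ->; rewrite eqxx conjCK.
rewrite w0 mul0r; have [iqj|_] := eqVneq i (q j); last by rewrite mulr0.
have [->|/vwi/(_ iqj)[_ <-]] := eqVneq (v j) 0; first by rewrite conjC0 mul0r.
by rewrite w0 mul0r.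
Qed.

(** One inclusion follows by testing on basis vectors. For the other, both inner products reduce to
    sums over the support of [w], which [p] maps bijectively onto the support of [v] with inverse
    [q]. *)
Lemma adjoint_weighted_comp :
  adjoint (weighted_comp p w) = weighted_comp q v.
Proof.
apply/seteqP; split => -[f g]; rewrite /adjoint /weighted_comp /=.
  move=> fg j; have := fg _ _ (weighted_comp_basis j).
  rewrite dotl2_basisl /dotl2 (@csum_single _ _ (q j)) /=; last first.
    by move=> i /negPf ->; rewrite mulr0 mul0r.
  by rewrite eqxx mulr1 -rmorphM => /(can_inj (@conjCK _)).
have [wP vP] := pq; move=> gE x y yE; rewrite /dotl2.
pose K := {i | w i != 0}.
have qpK (k : K) : q (p (val k)) = val k by have [] := wP _ (valP k).
rewrite (@csum_reindex_supp _ _ K val) /=; [|exact: val_inj|]; last first.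
  move=> i iw; rewrite yE; have [->|wi] := eqVneq (w i) 0.
    by rewrite !mul0r.
  by exfalso; apply: iw; exists (exist _ i wi).
rewrite [RHS](@csum_reindex_supp _ _ K (p \o val)) /=; last 2 first.
- by move=> k l /= /(congr1 q); rewrite !qpK => /val_inj.
- move=> j jp; rewrite gE; have [->|/vP[pqj wqj]] := eqVneq (v j) 0.
    by rewrite mul0r conjC0 mulr0.
  have [wq0|wq] := eqVneq (w (q j)) 0.
    by move: wqj; rewrite wq0 => /esym/eqP; rewrite conjC_eq0 => /eqP ->;
       rewrite mul0r conjC0 mulr0.
  by exfalso; apply: jp; exists (exist _ (q j) wq).
congr csum; apply/funext => k /=; have [qk vk] := wP _ (valP k).
by rewrite yE gE qk vk rmorphM /= conjCK mulrCA mulrA.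
Qed.

(** Finitely supported vectors lie in the domain: the image of a vector supported in A is supported
    in the finite image of A under [q]. *)
Lemma densely_defined_weighted_comp : densely_defined (weighted_comp p w).
Proof.
move=> f e e0.
have fin := rsummable_fin (fun i => abs2_ge0 (f i)) (rsummable_abs2 f).
(* The finite set A carries all but less than e^2 of the squared norm of f. *)
have [_ [A [finA _] <-]] := ub_ereal_sup_adherent (exprn_gt0 2 e0) fin.
rewrite -/(esum _ _) => Ae.
have gP : (fun i => if i \in A then f i else 0) \in @square_summable R I.
  apply: finite_support_square_summable; apply: sub_finite_set finA => i /=.
  by case: ifPn => [|_ /eqP//]; rewrite inE.
have kP : (fun i => w i * L2 gP (p i)) \in @square_summable R I.
  apply: finite_support_square_summable.
  apply: (@sub_finite_set _ _ (q @` A)); last exact: finite_image.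
  move=> i /=; case: ifPn => [|_]; last by rewrite mulr0 eqxx.
  rewrite inE mulf_eq0 negb_or => Ap /andP[wi _]; exists (p i) => //.
  by have [] := pq.1 i wi.
exists (L2 gP); first by exists (L2 kP).
rewrite /norml2 -[ltRHS]ger0_norm ?ltW// -sqrtr_sqr ltr_sqrt ?exprn_gt0//.
rewrite -lte_fin fineK; last first.
  exact: (rsummable_fin (fun i => abs2_ge0 _) (rsummable_abs2 (f - L2 gP))).
have splitA (a : I -> R) : (forall i, 0 <= a i) ->
    (\esum_(i in [set: I]) (a i)%:E =
     \sum_(i \in A) (a i)%:E + \esum_(i in ~` A) (a i)%:E)%E.
  move=> a0; rewrite (esumID A) => [|i _]; last by rewrite lee_fin.
  by rewrite !setTI esum_fset// => i _; rewrite lee_fin.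
rewrite splitA => [|i]; last exact: abs2_ge0.
rewrite fsbig1 ?add0e => [|i iA]; last first.
  by rewrite /= !fctE /= mem_set// subrr abs2E /= expr0n addr0.
move: Ae; rewrite splitA => [|i]; last exact: abs2_ge0.
rewrite lteBlDr// fsbig_finite// sumEFin lteD2lE//.
apply: le_lt_trans; apply: le_esum => i iA.
by rewrite /= !fctE /= memNset// subr0.
Qed.

End weighted_comp.

(** * Conjugations and unitary equivalence *)

Lemma abs2_unimodular (R : realType) (z : R[i]) : `|z| = 1 -> abs2 z = 1.
Proof. by case=> z1; rewrite /abs2 z1 expr1n. Qed.

Lemma unimodularK (R : realType) (z : R[i]) : `|z| = 1 -> z * z^* = 1.
Proof. by move=> z1; rewrite -normCK z1 expr1n. Qed.

Lemma square_summable_abs2 (R : realType) (I : choiceType) (f g : I -> R[i]) :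
  (forall i, abs2 (f i) = abs2 (g i)) ->
  g \in @square_summable R I -> f \in @square_summable R I.
Proof.
move=> fg; rewrite !unfold_in /square_summable.
by under [in X in _ -> X]eq_esum do rewrite fg.
Qed.

Lemma l2P (R : realType) (I : choiceType) (f g : l2 R I) :
  (forall i, f i = g i) -> f = g.
Proof. by move=> fg; apply/val_inj/funext. Qed.

Lemma conjugation0 (R : realType) (I : choiceType) (C : l2 R I -> l2 R I) :
  conjugation C -> C 0 = 0.
Proof.
move=> [Cl _ _]; have := Cl (- 1) 0 0.
by rewrite rmorphN rmorph1 !scaleN1r oppr0 addr0 addNr => ->.
Qed.

Lemma conjugationZ (R : realType) (I : choiceType) (C : l2 R I -> l2 R I) a f :
  conjugation C -> C (a *: f) = a^* *: C f.
Proof.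
move=> cC; have [Cl _ _] := cC.
by rewrite -[a *: f]addr0 Cl conjugation0// addr0.
Qed.

Lemma conj_op_adjointE (R : realType) (I : choiceType)
    (C : l2 R I -> l2 R I) (T : operator R I) f g :
  conjugation C ->
  conj_op C (adjoint T) (f, g) <-> adjoint T (C f, C g).
Proof.
move=> [_ CK _]; split => [[h /= hT ->]|Tfg]; first by rewrite CK.
by exists (C g) => //=; rewrite CK.
Qed.

Section flip_conj.
Variables (R : realType) (I : choiceType) (s : I -> I) (a : I -> R[i]).
Hypotheses (sK : involutive s) (a1 : forall k, `|a k| = 1).

Lemma flip_conj_subproof (f : l2 R I) :
  (fun k => a k * (f (s k))^*) \in @square_summable R I.
Proof.
have sI : injective s := can_inj sK.
apply: square_summable_abs2 (l2_funP (pull sI f)) => k.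
rewrite abs2M abs2_unimodular// mul1r !abs2E /=.
by case: (f (s k)) => x y /=; rewrite sqrrN.
Qed.

Definition flip_conj (f : l2 R I) : l2 R I := L2 (flip_conj_subproof f).

Hypothesis as_ : forall k, a (s k) = a k.

(** Applying the map twice multiplies coordinate k by [a k] times the conjugate of [a (s k)]; the
    invariance of [a] under [s] makes this factor 1. *)
Lemma conjugation_flip_conj : conjugation flip_conj.
Proof.
split.
- by move=> c f g; apply: l2P => k /=; rewrite !fctE /= rmorphD rmorphM; ring.
- move=> f; apply: l2P => k /=.
  by rewrite sK as_ rmorphM /= conjCK mulrA unimodularK ?mul1r.
- move=> f g; rewrite /dotl2 [RHS](@csum_reindex _ _ _ s); last by exists s.
  congr csum; apply/funext => k /=.
  rewrite rmorphM /= conjCK mulrACA unimodularK// mul1r.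
  by rewrite mulrC.
Qed.

(** The conjugate of the adjoint is again a weighted composition, along s o q o s, with the weight
    on the left of the second hypothesis. The index maps need to agree only where the weight is
    nonzero. *)
Lemma conj_op_flip_conj (p q : I -> I) (w v : I -> R[i]) :
  adjoint_weights p w q v ->
  (forall k, a k * (v (s k))^* * (a (q (s k)))^* = w k) ->
  (forall k, w k != 0 -> s (q (s k)) = p k) ->
  conj_op flip_conj (adjoint (weighted_comp p w)) = weighted_comp p w.
Proof.
move=> pq avw sqs; have e (f : l2 R I) k :
    a k * ((v (s k)) * (flip_conj f) (q (s k)))^* = w k * f (p k).
  rewrite /= rmorphM /= rmorphM /= conjCK !mulrA avw.
  have [->|wk] := eqVneq (w k) 0; first by rewrite !mul0r.
  by rewrite sqs.
apply/seteqP; split => -[f g].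
  move=> /(conj_op_adjointE _ _ _ conjugation_flip_conj).
  rewrite (adjoint_weighted_comp pq) => fg k /=.
  rewrite -e -fg /=.
  by rewrite rmorphM /= conjCK sK as_ mulrA unimodularK// mul1r.
move=> fg; apply/(conj_op_adjointE _ _ _ conjugation_flip_conj).
rewrite (adjoint_weighted_comp pq) => k /=; rewrite fg /= -e sK.
by rewrite as_ rmorphM /= conjCK (mulrA (a k)) unimodularK// mul1r.
Qed.

End flip_conj.

Section unitary.
Variables (R : realType) (I J : choiceType).

Lemma unitary_inj (U : l2 R I -> l2 R J) : unitary U -> injective U.
Proof.
move=> [_ _ Ud] f g fg; apply: l2_dot_inj => h.
by rewrite -Ud fg Ud.
Qed.

Lemma unitary_inv (U : l2 R I -> l2 R J) : unitary U ->
  exists V : l2 R J -> l2 R I, [/\ unitary V, cancel U V & cancel V U].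
Proof.
move=> uU; have UI := unitary_inj uU; have [Ul Us Ud] := uU.
have [V VK] := choice Us.
have UK : cancel U V by move=> f; apply: UI; rewrite VK.
exists V; split=> //; split.
- by move=> a f g; apply: UI; rewrite Ul !VK.
- by move=> f; exists (U f).
- by move=> f g; rewrite -Ud !VK.
Qed.

Variables (h : J -> I) (d : J -> R[i]).
Hypotheses (hB : bijective h) (d1 : forall j, `|d j| = 1).

Lemma relabel_subproof (f : l2 R I) :
  (fun j => d j * f (h j)) \in @square_summable R J.
Proof.
apply: square_summable_abs2 (l2_funP (pull (bij_inj hB) f)) => j.
by rewrite abs2M abs2_unimodular// mul1r.
Qed.

Definition relabel (f : l2 R I) : l2 R J := L2 (relabel_subproof f).

Lemma unitary_relabel : unitary relabel.
Proof.
split.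
- by move=> a f g; apply: l2P => j /=; rewrite !fctE /=; ring.
- move=> g; have [k hK kK] := hB.
  have kI : injective k := can_inj kK.
  have fP : (fun i => (d (k i))^* * g (k i)) \in @square_summable R I.
    apply: square_summable_abs2 (l2_funP (pull kI g)) => i.
    by rewrite abs2M abs2_unimodular ?mul1r// norm_conjC.
  exists (L2 fP); apply: l2P => j /=.
  by rewrite hK mulrA unimodularK// mul1r.
- move=> f g; rewrite /dotl2 [RHS](csum_reindex _ hB).
  congr csum; apply/funext => j /=.
  by rewrite rmorphM mulrACA unimodularK// mul1r.
Qed.

End unitary.

Section transfer.
Variables (R : realType) (I J : choiceType).
Variables (T : operator R I) (S : operator R J) (U : l2 R I -> l2 R J).
Hypotheses (uU : unitary U) (TS : forall f g, T (f, g) <-> S (U f, U g)).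

Lemma adjoint_transfer f g : adjoint T (f, g) <-> adjoint S (U f, U g).
Proof.
have [Ul Us Ud] := uU; split => fg h k /= hk.
  have [x xh] := Us h; have [y yk] := Us k; subst h k.
  by rewrite !Ud; apply: fg; apply/TS.
by rewrite -!Ud; apply: fg; apply/TS.
Qed.

Lemma conjugation_transfer (D : l2 R J -> l2 R J) : conjugation D ->
  exists C, conjugation C /\
    forall f g, conj_op C (adjoint T) (f, g) <->
                conj_op D (adjoint S) (U f, U g).
Proof.
move=> cD; have [Dl DK Dd] := cD; have [V [uV UK VK]] := unitary_inv uU.
have [[Ul _ Ud] [Vl _ Vd]] := (uU, uV).
have cC : conjugation (fun f => V (D (U f))).
  split.
  - by move=> a f g; rewrite Ul Dl Vl.
  - by move=> f; rewrite VK DK UK.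
  - by move=> f g; rewrite Vd Dd Ud.
exists (fun f => V (D (U f))); split=> // f g.
split; last first.
  move=> /(conj_op_adjointE _ _ _ cD) DfDg.
  apply/(conj_op_adjointE _ _ _ cC)/adjoint_transfer.
  by rewrite !VK.
move=> /(conj_op_adjointE _ _ _ cC)/adjoint_transfer; rewrite !VK.
by move=> /(conj_op_adjointE _ _ _ cD).
Qed.

Lemma conj_selfadjoint_transfer (D : l2 R J -> l2 R J) : conjugation D ->
  S = conj_op D (adjoint S) ->
  exists2 C, conjugation C & T = conj_op C (adjoint T).
Proof.
move=> /conjugation_transfer[C [cC CD]] SD; exists C => //.
apply/seteqP; split => -[f g].
  by move=> /TS; rewrite SD => /CD.
by move=> /CD; rewrite -SD => /TS.
Qed.

Lemma complex_symmetric_transfer : complex_symmetric S -> complex_symmetric T.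
Proof.
move=> [D /conjugation_transfer[C [cC CD]] [dS SD]]; exists C => //.
have [Ul Us Ud] := uU; split; last first.
  by move=> [f g] /TS /SD /CD.
move=> f e /(dS (U f)) [g [k gk]].
have [x xg] := Us g; have [y yk] := Us k; subst g k => fxe.
exists x; first by exists y; apply/TS.
have -> : norml2 (f - x) = norml2 (U f - U x); last by [].
have <- : U (f - x) = U f - U x by rewrite addrC -scaleN1r Ul scaleN1r addrC.
by rewrite !norml2E Ud.
Qed.

End transfer.

Lemma unitarily_equivalent_sym (R : realType) (I J : choiceType)
    (T : operator R I) (S : operator R J) :
  unitarily_equivalent T S -> unitarily_equivalent S T.
Proof.
move=> [U /unitary_inv [V [uV UK VK]] TS]; exists V => // f g.
by split => [|/TS]; rewrite ?VK//; move=> fg; apply/TS; rewrite !VK.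
Qed.

(** * Orthogonal sums *)

Lemma dotl20r (R : realType) (I : choiceType) (f : l2 R I) : dotl2 f 0 = 0.
Proof.
rewrite -(dotl20l f); congr csum; apply/funext => i /=.
by rewrite conjC0 mulr0 mul0r.
Qed.

(** C carries the orbit of f under the adjoint, step by step, to an orbit of [C f] under T. *)
Lemma conj_selfadjoint_dom_infty (R : realType) (I : choiceType)
    (C : l2 R I -> l2 R I) (T : operator R I) f :
  conjugation C -> T = conj_op C (adjoint T) ->
  dom_infty (adjoint T) f -> dom_infty T (C f).
Proof.
move=> cC TC fD n /fD [g fg]; exists (C g).
elim: n g fg => [|n IH] g /=; first by move=> ->.
move=> [h [/IH fh hg]]; exists (C h); split => //=.
rewrite TC; apply/(conj_op_adjointE _ _ _ cC).
by have [_ CK _] := cC; rewrite !CK.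
Qed.

Section orthogonal_sum.
Variables (R : realType) (X : finType) (I : X -> choiceType) (K : choiceType).
Variable h : forall x, I x -> K.
Hypothesis hI : forall x, injective (@h x).
Hypothesis h_cover : forall k, exists x i, @h x i = k.
Hypothesis h_disjoint : forall x y i j, @h x i = @h y j -> x = y.

Local Notation pull x := (pull (@hI x)).
Local Notation push x := (push (@hI x)).

Lemma l2_sumE (Y : Type) (s : seq Y) (P : pred Y) (F : Y -> l2 R K) k :
  (\sum_(y <- s | P y) F y) k = \sum_(y <- s | P y) F y k.
Proof. by elim/big_rec2: _ => // y f u _ <-. Qed.

Definition glue (F : forall x, l2 R (I x)) : l2 R K := \sum_x push x (F x).

Lemma pull_push_neq x y (f : l2 R (I y)) : y != x -> pull x (push y f) = 0.
Proof.
move=> yx; apply: l2P => i; apply: push_fun0 => j.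
by apply: contra_neqN yx => /eqP; exact: h_disjoint.
Qed.

Lemma pull_glue F x : pull x (glue F) = F x.
Proof.
apply: l2P => i; rewrite /= l2_sumE (bigD1 x)//= (push_funE (@hI x)).
rewrite big1 ?addr0// => y yx.
exact: (congr1 (fun u : l2 R (I x) => u i) (pull_push_neq (F y) yx)).
Qed.

Lemma pull_inj (f g : l2 R K) : (forall x, pull x f = pull x g) -> f = g.
Proof.
move=> fg; apply: l2P => k; have [x [i <-]] := h_cover k.
exact: (congr1 (fun u : l2 R (I x) => u i) (fg x)).
Qed.

Lemma dotl2_pull (f g : l2 R K) : dotl2 f g = \sum_x dotl2 (pull x f) (pull x g).
Proof.
have -> : f = glue (fun x => pull x f).
  by apply: pull_inj => x; rewrite pull_glue.
rewrite dotl2_suml; apply: eq_bigr => x _.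
by rewrite dotl2_push -/(glue _) pull_glue.
Qed.

Variable T : forall x, operator R (I x).

(** Covers both [opsum] (over [bool]) and [opbigsum] (over ['I_k]). *)
Definition orthogonal_sum : operator R K :=
  [set fg : l2 R K * l2 R K | forall x, T (pull x fg.1, pull x fg.2)].

(** Testing on one summand at a time uses pairs that vanish on the others, hence the hypothesis that
    each operator contains (0, 0). *)
Lemma adjoint_orthogonal_sum f g : (forall x, @T x (0, 0)) ->
  adjoint orthogonal_sum (f, g) <->
  forall x, adjoint (@T x) (pull x f, pull x g).
Proof.
move=> T0; split => [fg x a b ab|fg a b ab] /=; last first.
  by rewrite !dotl2_pull; apply: eq_bigr => x _; exact: fg.
rewrite -!dotl2_push; apply: fg => y /=.
have [->|yx] := eqVneq y x; first by rewrite !pushK.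
by rewrite !pull_push_neq// eq_sym.
Qed.

Lemma conj_selfadjoint_orthogonal_sum :
  (forall x, exists2 C, conjugation C & @T x = conj_op C (adjoint (@T x))) ->
  exists2 C, conjugation C & orthogonal_sum = conj_op C (adjoint orthogonal_sum).
Proof.
move=> CT.
pose C x := sval (cid2 (CT x)).
have cC x : conjugation (C x) by rewrite /C; case: cid2.
have CE x : @T x = conj_op (C x) (adjoint (@T x)) by rewrite /C; case: cid2.
(* An adjoint always contains (0, 0), hence so does its conjugate by [C x]. *)
have T0 x : @T x (0, 0).
  rewrite CE; apply/(conj_op_adjointE _ _ _ (cC x)) => a b _ /=.
  by rewrite (conjugation0 (cC x)) !dotl20r.
pose D f := glue (fun x => C x (pull x f)).
have cD : conjugation D.
  split.
  - move=> a f g; apply: pull_inj => x; have [Cl _ _] := cC x.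
    by rewrite pullP !pull_glue pullP Cl.
  - by move=> f; apply: pull_inj => x; have [_ CK _] := cC x; rewrite !pull_glue CK.
  - move=> f g; rewrite !dotl2_pull; apply: eq_bigr => x _.
    by have [_ _ Cd] := cC x; rewrite !pull_glue Cd.
exists D => //; apply/seteqP; split => -[f g].
  move=> fg; apply/(conj_op_adjointE _ _ _ cD)/adjoint_orthogonal_sum => // x.
  rewrite !pull_glue; apply/(conj_op_adjointE _ _ _ (cC x)).
  by rewrite -CE; exact: fg.
move=> /(conj_op_adjointE _ _ _ cD)/(adjoint_orthogonal_sum _ _ T0) fg x /=.
rewrite CE; apply/(conj_op_adjointE _ _ _ (cC x)).
by have := fg x; rewrite !pull_glue.
Qed.

End orthogonal_sum.

Section sums.
Variable R : realType.

Lemma existT_inj (X : eqType) (I : X -> Type) (x : X) : injective (existT I x).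
Proof.
by apply: Eqdep_dec.inj_pair2_eq_dec; exact: eq_comparable.
Qed.

Lemma opbigsumE k (I : 'I_k -> choiceType) (T : forall i, operator R (I i)) :
  opbigsum T = orthogonal_sum (fun i => @existT_inj _ I i) T.
Proof.
apply/seteqP; split => -[f g] fg i /=.
  have [[p q] /= Tpq pq] := fg i.
  suff [-> ->] : pull (@existT_inj _ I i) f = p /\ pull (@existT_inj _ I i) g = q.
    by [].
  by split; apply: l2P => x; have [] := pq x.
exists (pull (@existT_inj _ I i) f, pull (@existT_inj _ I i) g) => //.
Qed.

Lemma opsumE (I J : choiceType) (T : operator R I) (S : operator R J) f g :
  opsum T S (f, g) <->
  T (pull (@inl_inj I J) f, pull (@inl_inj I J) g) /\
  S (pull (@inr_inj I J) f, pull (@inr_inj I J) g).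
Proof.
split => [[[p p'] [[q q'] /= [Tp Sq fgp fgq]]]|[Tf Sg]].
  have -> : pull (@inl_inj I J) f = p by apply: l2P => i; have [] := fgp i.
  have -> : pull (@inl_inj I J) g = p' by apply: l2P => i; have [] := fgp i.
  have -> : pull (@inr_inj I J) f = q by apply: l2P => i; have [] := fgq i.
  by have -> : pull (@inr_inj I J) g = q' by apply: l2P => i; have [] := fgq i.
exists (pull (@inl_inj I J) f, pull (@inl_inj I J) g).
by exists (pull (@inr_inj I J) f, pull (@inr_inj I J) g).
Qed.

Lemma conj_selfadjoint_opbigsum k (I : 'I_k -> choiceType)
    (T : forall i, operator R (I i)) :
  (forall i, exists2 C, conjugation C & T i = conj_op C (adjoint (T i))) ->
  exists2 C, conjugation C & opbigsum T = conj_op C (adjoint (opbigsum T)).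
Proof.
rewrite opbigsumE; apply: conj_selfadjoint_orthogonal_sum.
- by move=> [i x]; exists i, x.
- by move=> i j x y /(congr1 tag).
Qed.

(** The two summands become a family over [bool], to which the results on finite orthogonal sums
    apply. *)
Let side (I J : choiceType) (b : bool) : choiceType := if b then I else J.
Let inject (I J : choiceType) (b : bool) : side I J b -> (I + J)%type :=
  if b as b return side I J b -> (I + J)%type then inl else inr.

Lemma conj_selfadjoint_opsum (I J : choiceType)
    (T : operator R I) (S : operator R J) :
  (exists2 C, conjugation C & T = conj_op C (adjoint T)) ->
  (exists2 C, conjugation C & S = conj_op C (adjoint S)) ->
  exists2 C, conjugation C & opsum T S = conj_op C (adjoint (opsum T S)).
Proof.
move=> CT CS.
have iI b : injective (@inject I J b) by case: b => x y [].
pose TS b : operator R (side I J b) :=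
  if b as b return operator R (side I J b) then T else S.
have -> : opsum T S = orthogonal_sum iI TS.
  apply/seteqP; split => -[f g].
    move=> /opsumE[Tf Sf] [] /=.
      rewrite (_ : pull (iI true) f = pull (@inl_inj I J) f); last exact: l2P.
      by rewrite (_ : pull (iI true) g = pull (@inl_inj I J) g); last exact: l2P.
    rewrite (_ : pull (iI false) f = pull (@inr_inj I J) f); last exact: l2P.
    by rewrite (_ : pull (iI false) g = pull (@inr_inj I J) g); last exact: l2P.
  move=> fg; apply/opsumE; split.
    have := fg true => /=.
    rewrite (_ : pull (iI true) f = pull (@inl_inj I J) f); last exact: l2P.
    by rewrite (_ : pull (iI true) g = pull (@inl_inj I J) g); last exact: l2P.
  have := fg false => /=.
  rewrite (_ : pull (iI false) f = pull (@inr_inj I J) f); last exact: l2P.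
  by rewrite (_ : pull (iI false) g = pull (@inr_inj I J) g); last exact: l2P.
apply: conj_selfadjoint_orthogonal_sum.
- by move=> [i|j]; [exists true, i|exists false, j].
- by move=> [] [] x y.
- by case.
Qed.

End sums.

(** * Shifts *)

Section shifts.
Variable R : realType.
Implicit Types (lam : int -> R[i]) (gam : nat -> R[i]).

Lemma bilateral_shiftE lam :
  bilateral_shift lam =
  weighted_comp (fun n => n - 1) (fun n => lam (n - 1)).
Proof. by []. Qed.

Lemma adjoint_weights_bilateral lam :
  adjoint_weights (fun n : int => n - 1) (fun n => lam (n - 1))
                  (fun n => n + 1) (fun n => (lam n)^*).
Proof. by split=> n _; rewrite ?subrK ?addrK ?conjCK. Qed.

Lemma adjoint_bilateral lam :
  adjoint (bilateral_shift lam) =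
  weighted_comp (fun n => n + 1) (fun n => (lam n)^*).
Proof.
rewrite bilateral_shiftE.
exact: adjoint_weighted_comp (adjoint_weights_bilateral lam).
Qed.

(** The value 0 at 0 encodes the vanishing of the first coordinate of the image and makes the
    convention [0.-1 = 0] harmless. *)
Definition shifted_weight gam n := if n is m.+1 then gam m else 0.

Lemma unilateral_shiftE gam :
  unilateral_shift gam = weighted_comp predn (shifted_weight gam).
Proof.
apply/seteqP; split => -[f g]; rewrite /unilateral_shift /weighted_comp /=.
  by move=> [g0 gS] [|n] /=; rewrite ?mul0r.
by move=> fg; split => [|n]; rewrite fg /= ?mul0r.
Qed.

Lemma adjoint_weights_unilateral gam :
  adjoint_weights predn (shifted_weight gam) succn (fun n => (gam n)^*).
Proof. by split => [[|n]|n] /=; rewrite ?eqxx ?conjCK. Qed.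

Lemma adjoint_unilateral gam :
  adjoint (unilateral_shift gam) = weighted_comp succn (fun n => (gam n)^*).
Proof.
rewrite unilateral_shiftE.
exact: adjoint_weighted_comp (adjoint_weights_unilateral gam).
Qed.

Lemma injective_unilateral gam :
  injective_op (unilateral_shift gam) <-> forall n, gam n != 0.
Proof.
split => [inj n|gam0 f g k [_ fk] [_ gk]]; last first.
  apply: l2P => n; apply: (mulfI (gam0 n)).
  by move: (fk n) (gk n) => /= <- <-.
apply/eqP => gn0.
(* A zero weight at n makes the shift send e_n to 0. *)
have : l2_basis R n = 0.
  apply: (inj _ _ 0); split => //= m.
    by have [->|_] := eqVneq m n; rewrite ?gn0 ?mul0r ?mulr0.
  by rewrite mulr0.
move=> /(congr1 (fun f : l2 R nat => f n)) /= /eqP.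
by rewrite eqxx oner_eq0.
Qed.

Lemma densely_defined_bilateral lam : densely_defined (bilateral_shift lam).
Proof. exact: densely_defined_weighted_comp (adjoint_weights_bilateral lam). Qed.

Lemma bilateral_basis lam n :
  bilateral_shift lam (l2_basis R n, lam n *: l2_basis R (n + 1)).
Proof.
have := weighted_comp_basis (adjoint_weights_bilateral lam) n.
by rewrite conjCK.
Qed.

Lemma dom_infty_adjoint_bilateral lam n :
  dom_infty (adjoint (bilateral_shift lam)) (l2_basis R n).
Proof.
move=> m _; suff [c cP] : exists c, oppow (adjoint (bilateral_shift lam)) m
    (l2_basis R n, c *: l2_basis R (n - m%:Z)).
  by exists (c *: l2_basis R (n - m%:Z)).
elim: m => [|m [c IH]]; first by exists 1; rewrite /= subr0 scale1r.
exists (c * (lam (n - m%:Z - 1))^*), (c *: l2_basis R (n - m%:Z)); split=> //.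
rewrite adjoint_bilateral => k /=.
have -> : (k == n - m.+1%:Z) = (k + 1 == n - m%:Z) by lia.
have [<-|_] := eqVneq (k + 1) (n - m%:Z); last by rewrite !mulr0.
by rewrite addrK !mulr1 mulrC.
Qed.

(** Equality and not mere inclusion: it moreover puts every C e_n in the domain of all powers of the
    shift, as e_n lies in the domain of all powers of the adjoint. *)
Definition symmetrizable lam :=
  exists2 C, conjugation C &
    bilateral_shift lam = conj_op C (adjoint (bilateral_shift lam)).

Lemma symmetrizable_dom_infty lam : symmetrizable lam ->
  exists C', [/\ conjugation C',
    forall n, dom_infty (bilateral_shift lam) (C' (l2_basis R n)) &
    C_symmetric C' (bilateral_shift lam)].
Proof.
move=> [C cC CE]; exists C; split=> //.
  move=> n; apply: conj_selfadjoint_dom_infty => //.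
  exact: dom_infty_adjoint_bilateral.
by split; [exact: densely_defined_bilateral|rewrite -CE].
Qed.

(** The recursion can be run backwards from 0 because [r] never vanishes. *)
Lemma int_rec_mul (r : int -> R[i]) : (forall n, r n != 0) ->
  exists d : int -> R[i], d 0 = 1 /\ forall n, d (n + 1) = r n * d n.
Proof.
move=> r0; pose d (n : int) := match n with
  | Posz n => \prod_(i < n) r (Posz i)
  | Negz n => (\prod_(i < n.+1) r (Negz i))^-1 end.
exists d; split; first exact: big_ord0.
move=> [n|[|n]].
- have -> : n%:Z + 1 = n.+1%:Z by lia.
  by rewrite /d big_ord_recr /= mulrC.
- have -> : Negz 0 + 1 = Posz 0 by [].
  by rewrite /d big_ord0 big_ord_recl big_ord0 mulr1 divff.
- have -> : Negz n.+1 + 1 = Negz n by lia.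
  rewrite /d [in RHS]big_ord_recr /= invfM mulrCA divff ?mulr1//.
Qed.

(** The conjugation is e_n |-> d n e_(s - n) with s = k + 1. Selfadjointness amounts to the
    recursion d (n + 1) lam (k - n) = lam n d n, and the hypothesis on moduli makes d unimodular.
    For the involution, n |-> d (s - n) satisfies the same recursion as d, hence is a multiple of
    it. *)
Lemma reflected_symmetrizable lam : reflected_weights lam -> symmetrizable lam.
Proof.
move=> [lam0 [k lamk]].
have r0 n : lam n / lam (k - n) != 0 by rewrite mulf_neq0 ?invr_neq0.
have [d [d0 dS]] := int_rec_mul r0.
have d1 n : `|d n| = 1.
  have dn m : `|d (m + 1)| = `|d m|.
    rewrite dS normrM normrM normfV -lamk divff ?mul1r//.
    by rewrite normr_eq0.
  elim/int_rec: n => [|n IH|n IH]; first by rewrite d0 normr1.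
    have -> : n.+1%:Z = n%:Z + 1 by lia.
    by rewrite dn.
  by rewrite -dn -[RHS]IH; congr `|d _|; lia.
pose s := k + 1.
have dsS n : d (s - (n + 1)) = lam n / lam (k - n) * d (s - n).
  have := dS (s - (n + 1)).
  have -> : s - (n + 1) + 1 = s - n by rewrite /s; lia.
  have -> : s - (n + 1) = k - n by rewrite /s; lia.
  have -> : k - (k - n) = n by lia.
  by move=> ->; rewrite mulrA mulrA divfK// divff// mul1r.
have ds n : d (s - n) = d n.
  have [c cE] : exists c, forall n, d (s - n) = c * d n.
    exists (d s); elim/int_rec => [|m IH|m IH].
    - by rewrite subr0 d0 mulr1.
    - have -> : m.+1%:Z = m%:Z + 1 by lia.
      rewrite dsS IH (dS m%:Z).
      by rewrite mulrCA.
    - apply: (mulfI (r0 (- m.+1%:Z))).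
      rewrite mulrCA -(dS (- m.+1%:Z)) -dsS.
      by have -> : - m.+1%:Z + 1 = - m%:Z by lia.
  (* A center of the reflection n |-> s - n shows that c = 1. *)
  suff [t dt] : exists t, d (s - t) = d t.
    have dt0 : d t != 0 by rewrite -normr_eq0 d1 oner_eq0.
    move: dt; rewrite !cE -[RHS]mul1r => /(mulIf dt0) ->.
    by rewrite mul1r.
  have := divz_eq s 2; have := modz_ge0 s (isT : (2 : int) != 0).
  have := @ltz_mod s 2 isT; exists (s %/ 2)%Z.
  set t := (s %/ 2)%Z; have [st|st] : s = t + t \/ s = t + t + 1 by lia.
    by congr d; lia.
  (* For odd s, the reflection exchanges t and t + 1; since k - t = t, the recursion has ratio 1
     there. *)
  have -> : s - t = t + 1 by lia.
  by rewrite dS (_ : k - t = t) ?divff ?mul1r//; rewrite /s in st; lia.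
have sK : involutive (fun n : int => s - n) by move=> n; lia.
exists (flip_conj sK d1); first exact: conjugation_flip_conj.
rewrite bilateral_shiftE; apply/esym.
apply: conj_op_flip_conj (adjoint_weights_bilateral lam) _ _ => // n; last by lia.
rewrite conjCK; have -> : s - n + 1 = s - (n - 1) by lia.
rewrite ds -[X in d X](subrK 1 n) dS.
have -> : k - (n - 1) = s - n by rewrite /s; lia.
set x := d (n - 1); rewrite -[RHS]mulr1 -(unimodularK (d1 (n - 1))) -/x.
by rewrite (mulrAC _ x) divfK// mulrA.
Qed.

(** Index maps for the sum of the adjoint and the shift: the adjoint reads coordinate n + 1, the
    shift coordinate n - 1. The fixed point [inr 0] of [sum_next] will carry the weight 0. *)
Definition sum_next (x : nat + nat) : nat + nat :=
  match x with inl n => inl n.+1 | inr n => inr n.-1 end.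
Definition sum_prev (x : nat + nat) : nat + nat :=
  match x with inl n => inl n.-1 | inr n => inr n.+1 end.
Definition sum_swap (x : nat + nat) : nat + nat :=
  match x with inl n => inr n | inr n => inl n end.

Lemma opsum_adjoint_unilateralE gam :
  opsum (adjoint (unilateral_shift gam)) (unilateral_shift gam) =
  weighted_comp sum_next
   (fun x => match x with inl n => (gam n)^* | inr n => shifted_weight gam n end).
Proof.
rewrite adjoint_unilateral unilateral_shiftE.
apply/seteqP; split => -[f g].
  by move=> /opsumE[fl fr] [n|n]; [exact: fl|exact: fr].
by move=> fg; apply/opsumE; split => n; [exact: (fg (inl n))|exact: (fg (inr n))].
Qed.

(** Exchanging the summands turns the adjoint of the sum back into the sum, except that
    antilinearity conjugates the weights; the phases [c] undo this. *)
Lemma conj_selfadjoint_opsum_unilateral gam : (forall n, gam n != 0) ->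
  exists2 C, conjugation C &
    opsum (adjoint (unilateral_shift gam)) (unilateral_shift gam) =
    conj_op C (adjoint
      (opsum (adjoint (unilateral_shift gam)) (unilateral_shift gam))).
Proof.
move=> gam0.
pose c n := \prod_(i < n) (gam i / (gam i)^*).
have c1 n : `|c n| = 1.
  rewrite /c normr_prod big1// => i _.
  by rewrite normrM normfV norm_conjC divff// normr_eq0.
have cS n : c n.+1 = c n * (gam n / (gam n)^*) by rewrite /c big_ord_recr.
have cj n : (gam n)^* != 0 by rewrite conjC_eq0.
pose a x := match x with inl n => c n | inr n => c n end.
have a1 x : `|a x| = 1 by case: x => n; exact: c1.
have sK : involutive sum_swap by case.
exists (flip_conj sK a1).
  by apply: conjugation_flip_conj => -[].
rewrite opsum_adjoint_unilateralE; apply/esym.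
apply: (@conj_op_flip_conj _ _ _ _ _ _ _ _ sum_prev _ (fun x => match x with
  inl n => shifted_weight gam n | inr n => (gam n)^* end)).
- by case.
- by split => [[n|[|n]]|[[|n]|n]] //=; rewrite ?eqxx ?conjCK.
- move=> [n|[|n]] /=.
  + rewrite conjCK cS !rmorphM /= fmorphV /= conjCK mulrACA unimodularK// mul1r.
    by rewrite mulrCA divff// mulr1.
  + by rewrite conjC0 mulr0 mul0r.
  + by rewrite cS mulrA divfK// mulrAC unimodularK// mul1r.
- by move=> [].
Qed.

Lemma shift_sum_symmetrizable lam : equiv_shift_sum lam -> symmetrizable lam.
Proof.
move=> [gam [/injective_unilateral gam0 [U uU WS]]].
have [C cC] := conj_selfadjoint_opsum_unilateral gam0.
exact: conj_selfadjoint_transfer uU WS _ cC.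
Qed.

Lemma shift_sum_truncated_symmetrizable lam :
  equiv_shift_sum_truncated lam -> symmetrizable lam.
Proof.
move=> [gam [k [m [mu [_ /injective_unilateral gam0 muC [U uU WS]]]]]].
have Cmu i : exists2 C, conjugation C &
    truncated_shift (mu i) = conj_op C (adjoint (truncated_shift (mu i))).
  by have [C cC [_ CE]] := muC i; exists C.
have [C cC CE] := conj_selfadjoint_opsum
  (conj_selfadjoint_opsum_unilateral gam0) (conj_selfadjoint_opbigsum Cmu).
exact: conj_selfadjoint_transfer uU WS _ cC CE.
Qed.

End shifts.

(** * Zeros unbounded on both sides *)

Lemma bounded_seq_int (s : seq int) : exists N, forall z, z \in s -> z < N.
Proof.
elim: s => [|x s [N sN]]; first by exists 0.
exists (Num.max (x + 1) N) => z; rewrite inE lt_max => /orP[/eqP ->|/sN ->].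
  by rewrite ltrDl.
by rewrite orbT.
Qed.

Lemma int_ex_min (P : int -> Prop) b x : (forall y, P y -> b <= y) -> P x ->
  exists2 z, P z & forall y, P y -> z <= y.
Proof.
move=> Pb Px; pose Q n := `[< P (b + n%:Z) >].
have QE y : P y -> Q `|y - b|%N.
  by move=> Py; apply/asboolP; rewrite gez0_abs ?subr_ge0 ?Pb// subrKC.
have [n /asboolP Pn nmin] := ex_minnP (ex_intro (fun n => Q n) _ (QE _ Px)).
exists (b + n%:Z) => // y Py; have := nmin _ (QE _ Py); have := Pb _ Py.
by lia.
Qed.

Section block_enumeration.
Variables (R : realType) (lam : int -> R[i]).
Hypothesis zeros_above : forall N, exists2 z, N <= z & lam z = 0.
Hypothesis zeros_below : forall N, exists2 z, z <= N & lam z = 0.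

Let block_end x : exists y, [/\ x <= y, lam y = 0 &
  forall t, x <= t -> t < y -> lam t != 0].
Proof.
have [z xz z0] := zeros_above x.
have [y [xy y0] ymin] :=
  @int_ex_min (fun y => x <= y /\ lam y = 0) x z (fun y => @proj1 _ _) (conj xz z0).
exists y; split=> // t xt ty; apply: contraTneq ty => t0.
by rewrite -leNgt ymin.
Qed.

Let block_start z : exists s, [/\ s <= z, lam (s - 1) = 0 &
  forall t, s <= t -> t < z -> lam t != 0].
Proof.
have [y yz y0] := zeros_below (z - 1).
(* Reflection turns the greatest zero below z into a least element. *)
pose P x := - x <= z - 1 /\ lam (- x) = 0.
have Pb x : P x -> 1 - z <= x by move=> [] /=; lia.
have Py : P (- y) by rewrite /P opprK.
have [x [xz x0] xmin] := int_ex_min Pb Py.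
exists (1 - x); split; first by lia.
  by rewrite [1 - x]addrC addrK.
move=> t xt tz; apply/eqP => t0; have := xmin (- t); rewrite /P opprK t0.
by move=> /(_ (conj _ erefl)); lia.
Qed.

(** The blocks between consecutive zeros are finite and countably many, so they can be traversed one
    after the other. After a zero, [phi] jumps to an index that is itself preceded by a zero, so the
    jump cuts no link of the shift. *)
Lemma block_enumeration : exists phi : nat -> int, [/\ bijective phi,
  lam (phi 0%N - 1) = 0,
  forall n, lam (phi n) = 0 -> lam (phi n.+1 - 1) = 0 &
  forall n, lam (phi n) != 0 -> phi n.+1 = phi n + 1].
Proof.
have infZ : infinite_set [set z | lam z = 0].
  move=> /finite_seqP[s sE]; have [N sN] := bounded_seq_int s.
  have [z Nz z0] := zeros_above N.
  have /sN : z \in s by have : [set z | lam z = 0] z by []; rewrite sE.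
  by lia.
have /card_set_bijP[zi [_ ziI ziS]] := eq_card_nat (countableP _) infZ.
have zE n : exists x, lam x = 0 /\ zi x = n.
  by have [x x0 <-] := ziS n I; exists x.
have [z zP] := choice zE.
have z0 n : lam (z n) = 0 by have [] := zP n.
have zK : cancel z zi by move=> n; have [] := zP n.
have zI := can_inj zK.
have ziP x : lam x = 0 -> z (zi x) = x.
  by move=> x0; apply: ziI; rewrite ?inE ?zK//=.
have [N NP] := choice block_end; have [S SP] := choice block_start.
have N_uniq x y : x <= y -> lam y = 0 ->
    (forall t, x <= t -> t < y -> lam t != 0) -> N x = y.
  move=> xy y0 xyt; have [xN N0 xNt] := NP x.
  have [yN|Ny|//] := ltgtP (N x) y.
  - by have := xyt _ xN yN; rewrite N0 eqxx.
  - by have := xNt _ xy Ny; rewrite y0 eqxx.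
(* A block ends at a zero of lam; B x is the rank of the zero N x ending the
   block of x in the enumeration z of the zeros, and S (z k) is the first index
   of the k-th block.  The function step runs through a block and then jumps to
   the next one. *)
pose B x := zi (N x).
have zB x : z (B x) = N x by have [_ N0 _] := NP x; rewrite ziP.
have BS k : B (S (z k)) = k.
  by apply: zI; rewrite zB; have [? ? ?] := SP (z k); exact: N_uniq.
have Bz k : B (z k) = k.
  by apply: zI; rewrite zB; apply: N_uniq => // t ? ?; lia.
have BD x : lam x != 0 -> B (x + 1) = B x.
  move=> x0; apply: zI; rewrite !zB; have [xN N0 xNt] := NP x.
  have xNe : x != N x by apply: contraNneq x0 => ->; rewrite N0.
  by apply: N_uniq => [|//|t ? ?]; [|apply: xNt]; lia.
pose step x := if lam x == 0 then S (z (B x).+1) else x + 1.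
pose phi n := iter n step (S (z 0%N)).
have phiS n : phi n.+1 = step (phi n) by [].
(* Lexicographic order on the rank of the block and the position in it; [step] increases strictly
   for it, so [phi] is injective. *)
pose lt x y := (B x < B y)%N \/ B x = B y /\ x < y.
have lt_trans x y t : lt x y -> lt y t -> lt x t by rewrite /lt; lia.
have lt_step x : lt x (step x).
  rewrite /lt /step; case: ifPn => x0; first by left; rewrite BS.
  by right; rewrite BD//; split => //; lia.
have lt_phi n m : lt (phi n) (phi (n + m.+1)%N).
  elim: m => [|m IH]; first by rewrite addn1.
  rewrite [(n + m.+2)%N]addnS phiS.
  exact: lt_trans IH (lt_step _).
have phiI : injective phi.
  move=> n m nm; have [ltnm|ltmn|//] := ltngtP n m.
    have := lt_phi n (m - n.+1)%N.
    by rewrite (_ : (n + (m - n.+1).+1)%N = m) ?nm /lt; lia.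
  have := lt_phi m (n - m.+1)%N.
  by rewrite (_ : (m + (n - m.+1).+1)%N = n) ?nm /lt; lia.
(* Surjectivity: from its first index, [phi] runs through a block up to the final zero, then reaches
   the first index of the next block. *)
have reach k j i : phi j = S (z k) -> S (z k) + i%:Z <= z k ->
    phi (j + i)%N = S (z k) + i%:Z.
  move=> jS; elim: i => [|i IH] ik; first by rewrite addn0 addr0.
  rewrite addnS phiS IH; last by lia.
  have [_ _ Sk] := SP (z k).
  by rewrite /step ifN ?Sk; lia.
have start k : exists j, phi j = S (z k).
  elim: k => [|k [j jS]]; first by exists 0%N.
  have [Sz _ _] := SP (z k).
  have := reach k j `|z k - S (z k)|%N jS.
  rewrite gez0_abs ?subr_ge0// subrKC => /(_ (lexx _)) jk.
  exists (j + `|z k - S (z k)|).+1%N; rewrite phiS jk /step z0 eqxx Bz//.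
have phiS' x : exists n, phi n = x.
  have [xN N0 xNt] := NP x; have [j jS] := start (B x).
  have [SN SN0 SNt] := SP (N x).
  have Sx : S (N x) <= x.
    rewrite leNgt; apply/negP => xS; have := xNt (S (N x) - 1).
    by rewrite SN0 eqxx; lia.
  exists (j + `|(x - S (N x))%R|)%N.
  by rewrite (reach (B x))// zB gez0_abs ?subr_ge0// subrKC.
have [psi psiK] := choice phiS'.
exists phi; split.
- by exists psi => // n; apply: phiI; rewrite psiK.
- by have [] := SP (z 0%N).
- move=> n n0; rewrite phiS /step n0 eqxx.
  by have [] := SP (z (B (phi n)).+1).
- by move=> n n0; rewrite phiS /step (negPf n0).
Qed.

Lemma unilateral_of_unbounded_zeros : exists gam,
  unitarily_equivalent (bilateral_shift lam) (unilateral_shift gam).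
Proof.
have [phi [phiB phi0 phiZ phiN]] := block_enumeration.
exists (lam \o phi).
have d1 (n : nat) : `|1 : R[i]| = 1 by exact: normr1.
exists (relabel phiB d1) => [|f g]; first exact: unitary_relabel.
(* After a zero, [phi n.+1 - 1] may differ from [phi n], but both weights vanish. *)
have key (n : nat) :
    lam (phi n.+1 - 1) * f (phi n.+1 - 1) = lam (phi n) * f (phi n).
  have [n0|n0] := eqVneq (lam (phi n)) 0; first by rewrite phiZ// n0 !mul0r.
  by rewrite phiN// addrK.
split => [fg|[/= g0 gS] x /=].
  split => [|n] /=; first by rewrite fg /= phi0 !mul0r mulr0.
  by rewrite !mul1r fg /= key.
have [psi _ psiK] := phiB; rewrite -(psiK x).
case: (psi x) => [|n]; first by rewrite phi0 mul0r -[LHS]mul1r.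
by rewrite key -[LHS]mul1r gS mul1r.
Qed.

End block_enumeration.

(** * Zeros bounded on both sides *)

Section two_tails.
Variables (R : realType) (lam : int -> R[i]) (b a : int).
Hypotheses (lam_b : lam b = 0) (lam_a : lam (a - 1) = 0).
Hypotheses (lam_right : forall n, a <= n -> lam n != 0).
Hypothesis lam_sym : forall n : nat, `|lam (b - 1 - n%:Z)| = `|lam (a + n%:Z)|.

Let gam (n : nat) := lam (a + n%:Z).

Let gam0 n : gam n != 0. Proof. by apply: lam_right; lia. Qed.

(** Going leftwards from b, the weights have the moduli of [gam]; the phases [d] absorb the
    arguments and turn the left tail into the adjoint of the unilateral shift. *)
Lemma left_phases : exists d : nat -> R[i], (forall n, `|d n| = 1) /\
  forall n, d n * lam (b - 1 - n%:Z) = (gam n)^* * d n.+1.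
Proof.
have gam0C n : (gam n)^* != 0 by rewrite conjC_eq0.
exists (fun n => \prod_(i < n) (lam (b - 1 - i%:Z) / (gam i)^*)); split => n.
  rewrite normr_prod big1// => i _.
  by rewrite normrM normfV norm_conjC lam_sym -/(gam i) divff ?normr_eq0 ?gam0.
by rewrite big_ord_recr /= [RHS]mulrC -mulrA divfK.
Qed.

(** The first condition is the bilateral shift on the coordinates up to b, the second the adjoint of
    the unilateral shift after relabelling with the phases [d]. *)
Lemma tails_equation (d : nat -> R[i]) (f g : int -> R[i]) :
  (forall n, `|d n| = 1) ->
  (forall n, d n * lam (b - 1 - n%:Z) = (gam n)^* * d n.+1) ->
  (forall n : nat, g (b - n%:Z) = lam (b - 1 - n%:Z) * f (b - 1 - n%:Z)) <->
  (forall n : nat, d n * g (b - n%:Z) = (gam n)^* * (d n.+1 * f (b - n.+1%:Z))).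
Proof.
move=> d1 dE; have e (n : nat) : b - n.+1%:Z = b - 1 - n%:Z by lia.
have d0 n : d n != 0 by rewrite -normr_eq0 d1 oner_eq0.
split => fg n; first by rewrite fg mulrA mulrA -dE e.
by apply: (mulfI (d0 n)); rewrite fg e !mulrA dE.
Qed.

(** The two tails exhaust the integers, and the zero at a - 1 = b separates them. *)
Lemma equiv_shift_sum_of_tails : a = b + 1 -> equiv_shift_sum lam.
Proof.
move=> ab; exists gam; split; first exact/injective_unilateral.
have [d [d1 dE]] := left_phases.
pose h (x : nat + nat) : int :=
  match x with inl n => b - n%:Z | inr n => a + n%:Z end.
have hB : bijective h.
  exists (fun x => if x <= b then inl (absz (b - x)) else inr (absz (x - a))).
    move=> [n|n] /=; first by rewrite ifT; [congr inl|]; lia.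
    by rewrite ifF; [congr inr|]; lia.
  by move=> x; case: ifPn => xb /=; lia.
pose e (x : nat + nat) := match x with inl n => d n | inr _ => 1 end.
have e1 x : `|e x| = 1 by case: x => n //=; rewrite normr1.
exists (relabel hB e1) => [|f g]; first exact: unitary_relabel.
split => [fg|/opsumE].
  apply/opsumE; rewrite adjoint_unilateral; split => /=.
    apply/(tails_equation f g d1 dE) => n.
    by rewrite fg /=; congr (lam _ * f _); lia.
  split => [|n] /=; first by rewrite fg /= addr0 lam_a mul0r mulr0.
  by rewrite !mul1r fg /=; congr (lam _ * f _); lia.
rewrite adjoint_unilateral.
move=> [/(tails_equation f g d1 dE) fgl [/= fga fgr] n] /=.
have [nb|bn] := leP n b.
  have [j ->] : exists j : nat, n = b - j%:Z by exists (absz (b - n)%R); lia.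
  by rewrite fgl; congr (lam _ * f _); lia.
have [na|na] := eqVneq n a.
  by rewrite na lam_a mul0r -fga mul1r addr0.
have [j ->] : exists j : nat, n = a + j.+1%:Z by exists (absz (n - a - 1)%R); lia.
by rewrite -[LHS]mul1r fgr mul1r; congr (lam _ * f _); lia.
Qed.

(** The middle part has the m + 1 indices b + 1, ..., a - 1, linked by m weights; the zeros at b and
    a - 1 detach it from the tails. It forms the only truncated summand. *)
Lemma equiv_shift_sum_truncated_of_tails (m : nat) : a = b + m.+2%:Z ->
  complex_selfadjoint
    (truncated_shift (fun i : 'I_m => lam (b + 1 + (i : nat)%:Z))) ->
  equiv_shift_sum_truncated lam.
Proof.
move=> ab Csym; exists gam, 1%N, (fun=> m), (fun _ i => lam (b + 1 + (i : nat)%:Z)).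
split => //; first exact/injective_unilateral.
have [d [d1 dE]] := left_phases.
pose K := ((nat + nat) + {i : 'I_1 & 'I_m.+1})%type.
pose h (x : K) : int := match x with
  | inl (inl n) => b - n%:Z
  | inl (inr n) => a + n%:Z
  | inr (existT _ j) => b + 1 + (j : nat)%:Z end.
have hB : bijective h.
  exists (fun x => if x <= b then inl (inl (absz (b - x)))
    else if a <= x then inl (inr (absz (x - a)))
    else inr (existT _ ord0 (inord (absz (x - (b + 1))%R)))).
    move=> [[n|n]|[i j]] /=.
    - by rewrite ifT; [congr (inl (inl _))|]; lia.
    - have -> : (a + n%:Z <= b) = false by lia.
      have -> : a <= a + n%:Z by lia.
      by congr (inl (inr _)); lia.
    - have jm := ltn_ord j; rewrite /= in jm.
      have -> : (b + 1 + (j : nat)%:Z <= b) = false by lia.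
      have -> : (a <= b + 1 + (j : nat)%:Z) = false by lia.
      rewrite (ord1 i); congr (inr (existT _ _ _)); apply: val_inj.
      by rewrite /= inordK; lia.
  move=> x; case: ifPn => xb /=; first by lia.
  by case: ifPn => ax /=; rewrite ?inordK; lia.
pose e (x : K) := match x with inl (inl n) => d n | _ => 1 end.
have e1 x : `|e x| = 1 by case: x => [[n|n]|x] //=; rewrite normr1.
exists (relabel hB e1) => [|f g]; first exact: unitary_relabel.
split => [fg|/opsumE].
  apply/opsumE; rewrite opbigsumE; split; last first.
    move=> i; split => [|j] /=.
      by rewrite fg /= addr0 addrK lam_b mul0r mulr0.
    rewrite !mul1r fg /= /bump leq0n add1n.
    by congr (lam _ * f _); lia.
  apply/opsumE; rewrite adjoint_unilateral; split => /=.
    apply/(tails_equation f g d1 dE) => n.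
    by rewrite fg /=; congr (lam _ * f _); lia.
  split => [|n] /=; first by rewrite fg /= addr0 lam_a mul0r mulr0.
  by rewrite !mul1r fg /=; congr (lam _ * f _); lia.
rewrite opbigsumE adjoint_unilateral => -[/opsumE[]].
move=> /(tails_equation f g d1 dE) fgl [/= fga fgr] /(_ ord0)[/= fg0 fgm] n /=.
have [nb|bn] := leP n b.
  have [j ->] : exists j : nat, n = b - j%:Z by exists (absz (b - n)%R); lia.
  by rewrite fgl; congr (lam _ * f _); lia.
have [an|na] := leP a n.
  have [nEa|nNa] := eqVneq n a.
    by rewrite nEa lam_a mul0r -fga mul1r addr0.
  have [j ->] : exists j : nat, n = a + j.+1%:Z by exists (absz (n - a - 1)%R); lia.
  by rewrite -[LHS]mul1r fgr mul1r; congr (lam _ * f _); lia.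
have [nb|nb] := eqVneq n (b + 1).
  by rewrite nb addrK lam_b mul0r -fg0 mul1r addr0.
have [j nE] : exists j : nat, n = b + 1 + j.+1%:Z.
  by exists (absz (n - b - 2)%R); lia.
have jm : (j < m)%N by lia.
rewrite nE -[LHS]mul1r (fgm (Ordinal jm)) mul1r /=.
by congr (lam _ * f _); lia.
Qed.

End two_tails.

(** * The kernel of the conjugation *)

Section compression.
Variables (R : realType) (I J : choiceType) (h : J -> I) (hI : injective h).
Variable C : l2 R I -> l2 R I.
Hypothesis cC : conjugation C.
Hypothesis C_range : forall i j, (forall k, h k != i) -> C (l2_basis R i) (h j) = 0.

(** For i outside the range of [h], coordinate i of C (push f) is the inner product of C e_i with
    push f, because e_i = C (C e_i); it vanishes since C e_i is zero on the range. *)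
Lemma push_pull_conj f : push hI (pull hI (C (push hI f))) = C (push hI f).
Proof.
have [_ CK Cd] := cC; apply: l2P => i.
have [[j <-]|hi] := pselect (exists j, h j = i); first by rewrite pushE.
have {}hi j : h j != i by apply/eqP => e; apply: hi; exists j.
rewrite push0// -dotl2_basisr -[l2_basis R i]CK Cd dotl2_pushr.
by rewrite [pull _ _](_ : _ = 0) ?dotl20l//; apply: l2P => j /=; exact: C_range.
Qed.

Definition compress f := pull hI (C (push hI f)).

Lemma conjugation_compress : conjugation compress.
Proof.
have [Cl CK Cd] := cC; split.
- by move=> a f g; rewrite /compress pushP Cl pullP.
- by move=> f; rewrite /compress push_pull_conj CK pushK.
- by move=> f g; rewrite /compress -dotl2_push push_pull_conj Cd dotl2_push pushK.
Qed.

Lemma compress_symmetric (T : operator R I) (S : operator R J) f g :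
  T `<=` conj_op C (adjoint T) ->
  (forall f g, S (f, g) -> T (push hI f, push hI g)) ->
  S (f, g) -> adjoint S (compress f, compress g).
Proof.
move=> TC ST Sfg x y /ST Txy; rewrite /= /compress -!dotl2_push.
by have /TC/(conj_op_adjointE _ _ _ cC) := ST _ _ Sfg; exact.
Qed.

End compression.

Section truncated.
Variables (R : realType) (m : nat) (mu : 'I_m -> R[i]).

Lemma truncated_total f : exists g, truncated_shift mu (f, g).
Proof.
pose g (i : 'I_m.+1) := if unlift ord0 i is Some j
  then mu j * f (widen_ord (leqnSn m) j) else 0.
have gP : g \in @square_summable R _.
  by apply: finite_support_square_summable; exact: finite_finset.
exists (L2 gP); split => [|i] /=; first by rewrite /g unlift_none.
by rewrite /g liftK.
Qed.

(** Inclusion suffices in finite dimension: the truncated shift is defined everywhere and the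
    conjugated adjoint is single-valued, so the latter cannot be a proper extension. *)
Lemma complex_selfadjoint_truncated (D : l2 R 'I_m.+1 -> l2 R 'I_m.+1) :
  conjugation D ->
  (forall f g, truncated_shift mu (f, g) ->
    adjoint (truncated_shift mu) (D f, D g)) ->
  complex_selfadjoint (truncated_shift mu).
Proof.
move=> cD sym; exists D => //; split.
  move=> f e e0; exists f; first exact: truncated_total.
  by rewrite norml2E subrr dotl20l /= sqrtr0.
apply/seteqP; split => -[f g].
  by move=> /sym fg; apply/(conj_op_adjointE _ _ _ cD).
move=> /(conj_op_adjointE _ _ _ cD) fg.
have [k fk] := truncated_total f; suff -> : g = k by [].
have [_ DK _] := cD; rewrite -(DK g) -(DK k); congr D.
apply: l2P => i; apply: (can_inj (@conjCK R[i])).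
have [y iy] := truncated_total (l2_basis R i).
by rewrite -!dotl2_basisl -(fg _ _ iy) -(sym _ _ fk _ _ iy).
Qed.

End truncated.

(** * From the kernel identities to the four cases *)

Section necessity.
Variables (R : realType) (lam : int -> R[i]) (C : l2 R int -> l2 R int).
Hypothesis cC : conjugation C.
Hypothesis domC : forall n, dom (bilateral_shift lam) (C (l2_basis R n)).
Hypothesis symC : bilateral_shift lam `<=` conj_op C (adjoint (bilateral_shift lam)).

Local Notation kk m n := (C (l2_basis R n) m).

Lemma kernel_sym m n : kk m n = kk n m.
Proof.
have [_ CK Cd] := cC.
by have := Cd (l2_basis R n) (C (l2_basis R m)); rewrite CK !dotl2_basisr.
Qed.

Lemma kernel_adjoint m n : (lam n)^* * kk m (n + 1) = (lam m)^* * kk (m + 1) n.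
Proof.
have /(conj_op_adjointE _ _ _ cC) := symC (bilateral_basis lam n).
rewrite adjoint_bilateral conjugationZ// => /(_ m) /=.
by [].
Qed.

(** Since C e_(n+1) lies in the domain, symmetry shows that C maps its image under the shift to the
    image of e_(n+1) under the adjoint. Hence W C e_(n+1) = lam n C e_n, read here at coordinate m +
    1. *)
Lemma kernel_shift m n : lam m * kk m (n + 1) = lam n * kk (m + 1) n.
Proof.
have [g Wg] := domC (n + 1).
have [_ CK _] := cC.
have := symC Wg => /(conj_op_adjointE _ _ _ cC); rewrite CK.
rewrite adjoint_bilateral => Cg.
have CgE : C g = (lam n)^* *: l2_basis R n.
  apply: l2P => i; rewrite Cg /=.
  have -> : (i + 1 == n + 1) = (i == n) by lia.
  by have [->|_] := eqVneq i n; rewrite ?mulr0.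
have := Wg (m + 1); rewrite /= addrK => <-.
by rewrite -[g]CK CgE conjugationZ// conjCK.
Qed.

(** Multiplying the first kernel identity by lam (p - 1) and inserting the second gives |lam (p -
    1)|^2 k(p, q) = |lam q|^2 k(p, q). *)
Lemma kernel_norm p q : kk p q != 0 -> `|lam (p - 1)| = `|lam q|.
Proof.
move=> k0; apply: (pexpIrn (n := 2)) => //; rewrite ?nnegrE//.
rewrite !normCK; apply: (mulIf k0).
have := kernel_adjoint (p - 1) q; have := kernel_shift (p - 1) q.
rewrite subrK => s a.
by rewrite -mulrA -a mulrCA s mulrCA mulrA.
Qed.

Lemma kernel_step p q : kk p q != 0 -> lam (p - 1) != 0 -> kk (p - 1) (q + 1) != 0.
Proof.
move=> k0 p0; have := kernel_shift (p - 1) q; rewrite subrK => s.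
have q0 : lam q != 0 by rewrite -normr_eq0 -(kernel_norm k0) normr_eq0.
by apply: contra_neq (mulf_neq0 q0 k0) => k1; rewrite -s k1 mulr0.
Qed.

Lemma kernel_chain p q (j : nat) : kk p q != 0 ->
  (forall i : nat, (i < j)%N -> lam (p - 1 - i%:Z) != 0) ->
  kk (p - j%:Z) (q + j%:Z) != 0.
Proof.
move=> k0; elim: j => [|j IH] pj; first by rewrite subr0 addr0.
have -> : p - j.+1%:Z = p - j%:Z - 1 by lia.
have -> : q + j.+1%:Z = q + j%:Z + 1 by lia.
apply: kernel_step; first by apply: IH => i ij; apply: pj; lia.
by have := pj j (ltnSn j); rewrite addrAC.
Qed.

Lemma kernel_tail p q (j : nat) : kk p q != 0 ->
  (forall i : nat, lam (p - 1 - i%:Z) != 0) ->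
  `|lam (p - 1 - j%:Z)| = `|lam (q + j%:Z)|.
Proof.
move=> k0 p0; have /kernel_norm <- : kk (p - j%:Z) (q + j%:Z) != 0.
  by apply: kernel_chain.
by rewrite addrAC.
Qed.

(** Strong induction along the antidiagonal: each left weight has the modulus of a right one, hence
    is nonzero, which allows the next step. *)
Lemma kernel_tail_r p q : kk p q != 0 ->
  (forall i : nat, lam (q + i%:Z) != 0) ->
  forall i : nat, lam (p - 1 - i%:Z) != 0.
Proof.
move=> k0 q0 i; rewrite -normr_eq0.
suff /kernel_norm : kk (p - i%:Z) (q + i%:Z) != 0.
  by rewrite addrAC => ->; rewrite normr_eq0.
elim/ltn_ind: i => i IH; apply: kernel_chain => // j ji.
by rewrite -normr_eq0 addrAC (kernel_norm (IH j ji)) normr_eq0.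
Qed.

Lemma kernel_neq0 n : exists m, kk m n != 0.
Proof.
apply: contrapT => kn; have [_ CK _] := cC.
have : C (l2_basis R n) = 0.
  by apply: l2P => m; apply/eqP; apply: contrapT => /negP k; apply: kn; exists m.
move=> /(congr1 C); rewrite CK conjugation0//.
move=> /(congr1 (fun f : l2 R int => f n)) /= /eqP.
by rewrite eqxx oner_eq0.
Qed.

Lemma reflected_of_symmetric : (forall n, lam n != 0) -> reflected_weights lam.
Proof.
move=> lam0; split=> //; have [m k0] := kernel_neq0 0.
have kj (j : int) : kk (m - j) j != 0.
  case: j => j; first by have := @kernel_chain m 0 j k0; rewrite add0r; exact.
  (* Negative j is reached from the transposed entry (0, m). *)
  rewrite kernel_sym; have k0' : kk 0 m != 0 by rewrite kernel_sym.
  have := @kernel_chain 0 m j.+1 k0' (fun _ _ => lam0 _).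
  by rewrite sub0r NegzE opprK.
exists (m - 1) => n; rewrite -(kernel_norm (kj n)).
by congr `|lam _|; lia.
Qed.

Section with_tails.
Variables b a : int.
Hypotheses (lam_b : lam b = 0) (lam_a : lam (a - 1) = 0).
Hypotheses (lam_left : forall n, n < b -> lam n != 0).
Hypotheses (lam_right : forall n, a <= n -> lam n != 0).

(** If x <= b, the antidiagonal matches the nonzero left tail with the weights from n on, among
    which lam (a - 1) = 0. If x >= a, the nonzero right tail forces the weights left of n to be
    nonzero, among them lam b = 0. *)
Lemma kernel_middle x n : b < n -> n < a -> kk x n != 0 -> b < x /\ x < a.
Proof.
move=> bn na k0; split; rewrite ltNge; apply/negP => xb.
  have p0 (i : nat) : lam (x - 1 - i%:Z) != 0 by apply: lam_left; lia.
  have := kernel_tail (absz (a - 1 - n)%R) k0 p0.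
  rewrite gez0_abs; last by lia.
  rewrite subrKC lam_a normr0 => /normr0_eq0 /eqP.
  by apply/negP; apply: lam_left; lia.
have q0 (i : nat) : lam (x + i%:Z) != 0 by apply: lam_right; lia.
rewrite kernel_sym in k0; have := kernel_tail_r k0 q0 (absz (n - 1 - b)%R).
rewrite gez0_abs; last by lia.
by rewrite subKr lam_b eqxx.
Qed.

Lemma complex_selfadjoint_middle m : a = b + m.+2%:Z ->
  complex_selfadjoint
    (truncated_shift (fun i : 'I_m => lam (b + 1 + (i : nat)%:Z))).
Proof.
move=> ab; pose h (i : 'I_m.+1) : int := b + 1 + (i : nat)%:Z.
have hI : injective h by move=> i j ij; apply: ord_inj; rewrite /h in ij; lia.
have h_range n : b < n -> n < a -> exists i, h i = n.
  move=> bn na; have im : (absz (n - b - 1)%R < m.+1)%N by lia.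
  by exists (Ordinal im); rewrite /h /=; lia.
have hC i j : (forall k, h k != i) -> C (l2_basis R i) (h j) = 0.
  move=> hi; apply/eqP/negPn/negP; rewrite kernel_sym => /kernel_middle[].
  - by rewrite /h; have := ltn_ord j; lia.
  - by rewrite /h; have := ltn_ord j; lia.
  by move=> bi ia; have [k /eqP] := h_range i bi ia; apply/negP.
apply: (complex_selfadjoint_truncated (conjugation_compress hI cC hC)) => f g.
apply: compress_symmetric symC _ => {f g} // f g [/= g0 gS] n /=.
have [[i <-]|hn] := pselect (exists i, h i = n).
  rewrite push_funE//; have [i' ->|->] := unliftP ord0 i; last first.
    by rewrite g0 /h /= addr0 addrK lam_b mul0r.
  rewrite gS -(push_funE hI f) /h /= /bump leq0n add1n.
  by have -> : b + 1 + i'.+1%:Z - 1 = b + 1 + (i' : nat)%:Z by lia.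
rewrite push_fun0; last by move=> j; apply/eqP => e; apply: hn; exists j.
(* At n = a, the last coordinate of the middle part would enter, but its weight lam (a - 1) is 0. *)
have [->|na] := eqVneq n a; first by rewrite lam_a mul0r.
rewrite push_fun0 ?mulr0// => j; apply/eqP => e; apply: hn; apply: h_range.
  by rewrite /h in e; lia.
by rewrite /h in e; have := ltn_ord j; lia.
Qed.

End with_tails.

Lemma shift_sums_of_tail b0 z : (forall n, n < b0 -> lam n != 0) -> lam z = 0 ->
  equiv_shift_sum lam \/ equiv_shift_sum_truncated lam.
Proof.
move=> lam_b0 z0.
have [b lam_b b_min] : exists2 b, lam b = 0 & forall y, lam y = 0 -> b <= y.
  apply: (@int_ex_min _ b0 z) => // y y0; rewrite leNgt; apply/negP => /lam_b0.
  by rewrite y0 eqxx.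
have lam_left n : n < b -> lam n != 0.
  by move=> nb; apply/eqP => /b_min; rewrite leNgt nb.
have [a k0] := kernel_neq0 b; rewrite kernel_sym in k0.
(* As [kk b a] is nonzero and no weight vanishes left of b, the weights from a on match the left
   tail in modulus; the transposed entry gives |lam (a - 1)| = |lam b| = 0. *)
have left_nat (i : nat) : lam (b - 1 - i%:Z) != 0 by apply: lam_left; lia.
have tail j := kernel_tail j k0 left_nat.
have lam_right n : a <= n -> lam n != 0.
  move=> an; have -> : n = a + (absz (n - a)%R)%:Z by lia.
  by rewrite -normr_eq0 -tail normr_eq0.
have lam_a : lam (a - 1) = 0.
  apply/eqP; rewrite kernel_sym in k0.
  by rewrite -normr_eq0 (kernel_norm k0) lam_b normr0.
have ab := b_min _ lam_a.
have [ab1|ab1] := eqVneq a (b + 1).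
  by left; exact: equiv_shift_sum_of_tails tail ab1.
right; have [m am] : exists m : nat, a = b + m.+2%:Z.
  by exists (absz (a - b - 2)%R); lia.
apply: (equiv_shift_sum_truncated_of_tails lam_b lam_a lam_right tail am).
by have := complex_selfadjoint_middle lam_b lam_a lam_left lam_right am.
Qed.

Lemma classification : densely_defined (bilateral_shift lam) ->
  [\/ reflected_weights lam, equiv_shift_sum lam,
      equiv_shift_sum_truncated lam | equiv_symmetric_unilateral lam].
Proof.
move=> dW.
have [lam0|] := pselect (forall n, lam n != 0).
  by constructor 1; exact: reflected_of_symmetric.
move=> /existsNP[z /negP/negPn/eqP z0].
have tails : (exists b0, forall n, n < b0 -> lam n != 0) ->
    [\/ reflected_weights lam, equiv_shift_sum lam,
      equiv_shift_sum_truncated lam | equiv_symmetric_unilateral lam].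
  by move=> [b0 /shift_sums_of_tail/(_ z0)[]]; [constructor 2|constructor 3].
have [/tails//|no_below] := pselect (exists b0, forall n, n < b0 -> lam n != 0).
(* Zeros bounded above are also bounded below: through the kernel, a right tail without zeros forces
   such a tail on the left. *)
have [[a lam_a]|no_above] := pselect (exists a, forall n, a <= n -> lam n != 0).
  apply: tails; have [p k0] := kernel_neq0 a.
  have a_nat (i : nat) : lam (a + i%:Z) != 0 by apply: lam_a; lia.
  exists p => n np; have -> : n = p - 1 - (absz (p - 1 - n)%R)%:Z by lia.
  exact: kernel_tail_r k0 a_nat _.
have above N : exists2 z, N <= z & lam z = 0.
  apply: contrapT => no; apply: no_above; exists N => n Nn.
  by apply/eqP => n0; apply: no; exists n.
have below N : exists2 z, z <= N & lam z = 0.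
  apply: contrapT => no; apply: no_below; exists N => n nN.
  by apply/eqP => n0; apply: no; exists n => //; exact: ltW.
constructor 4; have [gam Wgam] := unilateral_of_unbounded_zeros above below.
(* The unilateral shift inherits complex symmetry from C through the unitary equivalence. *)
exists gam; split=> //; have [V uV VW] := unitarily_equivalent_sym Wgam.
by apply: (complex_symmetric_transfer uV VW); exists C.
Qed.

End necessity.

(** Conditions (i)-(iv) do not mention C, so the converse asserts the existence of a suitable
    conjugation. It cannot concern every given C: with all weights equal to 1, entrywise complex
    conjugation satisfies [hE], yet conjugating the adjoint by it gives the backward shift. In case
    (iv), the conjugation is not claimed to send the basis into the domain of all powers. *)
Theorem theorem30 (R : realType) (lam : int -> R[i])
    (C : l2 R int -> l2 R int) (hC : conjugation C)
    (hE : forall n : int, dom_infty (bilateral_shift lam) (C (l2_basis R n))) :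
  (C_symmetric C (bilateral_shift lam) ->
     [\/ reflected_weights lam, equiv_shift_sum lam,
         equiv_shift_sum_truncated lam | equiv_symmetric_unilateral lam]) /\
  ([\/ reflected_weights lam, equiv_shift_sum lam |
       equiv_shift_sum_truncated lam] ->
     exists C' : l2 R int -> l2 R int,
       [/\ conjugation C',
           forall n : int,
             dom_infty (bilateral_shift lam) (C' (l2_basis R n)) &
           C_symmetric C' (bilateral_shift lam)]) /\
  (equiv_symmetric_unilateral lam -> complex_symmetric (bilateral_shift lam)).
Proof.
split=> [[dW symC]|].
  apply: classification hC _ symC dW => n.
  by have [g [h [/= -> Wg]]] := hE n 1%N isT; exists g.
split=> [cases|[gam [gamC [U uU WU]]]]; last first.
  exact: complex_symmetric_transfer uU WU gamC.
apply: symmetrizable_dom_infty; case: cases.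
- exact: reflected_symmetrizable.
- exact: shift_sum_symmetrizable.
- exact: shift_sum_truncated_symmetrizable.
Qed.
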